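(* For every $n\in\mathbb{N}$, $n\geq 1$, the prequantization $(N^{2n+1},\xi)$ of $\mathbb{CP}^1\times\cdots\times\mathbb{CP}^1$ ($n$ factors) with toric symplectic form $\omega$ such that $[\omega]=c_1(\mathbb{CP}^1\times\cdots\times\mathbb{CP}^1)/2$ is a rigid Gorenstein toric contact manifold.
   Context: A toric diagram is an integral simplicial $n$-polytope $\mathcal{D}\subset\mathbb{R}^n$ all of whose facets are unimodular simplices (the $n$ vertices of each facet can be translated to form a basis of $\mathbb{Z}^n$). Unimodular equivalence of polytopes in $\mathbb{R}^n$ means equivalence under integral translations and $GL(n,\mathbb{Z})$. Toric diagrams $\mathcal{D}=\operatorname{conv}(v_1,\dots,v_d)$, up to unimodular equivalence, correspond bijectively to Gorenstein toric contact manifolds (good toric contact manifolds with zero first Chern class) $(N_{\mathcal{D}}^{2n+1},\xi_{\mathcal{D}})$: the moment cone of the symplectization has defining normals $(v_j,1)\in\mathbb{Z}^{n+1}$. The prequantization of $(M^{2n},\omega)$ is the $S^1$-bundle over $M$ with Chern class $\frac{1}{2\pi}[\omega]\in H^2(M;\mathbb{Z})$, with contact structure the horizontal distribution of a connection form with curvature $\frac{1}{2\pi}\omega$ (convention: $c_1(M)$ is normalized so that $\frac{1}{2\pi}c_1(M)$ is the integral first Chern class). The prequantization in the statement, whose base has moment polytope the unit cube $[0,1]^n$, is the Gorenstein toric contact manifold whose toric diagram is the small cross-polytope $$S_n=\operatorname{conv}\big(\{0,\ e_n\}\cup\{e_i: 1\le i\le n-1\}\cup\{e_n-e_i:1\le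 i\le n-1\}\big)\subset\mathbb{R}^n,$$ where $e_1,\dots,e_n$ is the standard basis. The Ehrhart polynomial of $\mathcal{D}$ is $L_{\mathcal{D}}(t)=\#(t\mathcal{D}\cap\mathbb{Z}^n)$, $t\in\mathbb{Z}_{>0}$, written $L_{\mathcal{D}}(t)=\sum_{k=0}^n h^*_k(\mathcal{D})\binom{t+n-k}{n}$. The contact Betti numbers $cb_*(N_{\mathcal{D}},\xi_{\mathcal{D}})$ (ranks of cylindrical contact homology) vanish in negative and odd degrees and satisfy $h^*_{n-k}(\mathcal{D})=cb_{2k}-cb_{2(k-1)}$, so they are equivalent data to $L_{\mathcal{D}}$. A Gorenstein toric contact manifold $(N_{\mathcal{D}},\xi_{\mathcal{D}})$ is rigid if it is completely determined, as a toric contact manifold, by its contact Betti numbers; equivalently, if its toric diagram $\mathcal{D}$ is Ehrhart determined, i.e. every toric diagram $\mathcal{D}'\subset\mathbb{R}^n$ with $L_{\mathcal{D}'}(t)=L_{\mathcal{D}}(t)$ is unimodularly equivalent to $\mathcal{D}$. *)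

(* Defs.v *)
From mathcomp Require Import all_boot all_order all_algebra finmap.
From mathcomp Require Import boolp classical_sets functions cardinality reals.

Set Implicit Arguments.
Unset Strict Implicit.
Unset Printing Implicit Defensive.

Import Order.TTheory GRing.Theory Num.Theory.

Local Open Scope classical_set_scope.
Local Open Scope ring_scope.

Definition lat (R : realType) n (z : 'rV[int]_n) : 'rV[R]_n := map_mx intr z.

Definition dot (R : realType) n (x y : 'rV[R]_n) : R :=
  \sum_(i < n) x 0 i * y 0 i.

Definition conv (R : realType) n (s : seq 'rV[R]_n) : set 'rV[R]_n :=
  [set x | exists c : 'I_(size s) -> R,
    [/\ forall i, 0 <= c i, \sum_i c i = 1 & x = \sum_i c i *: s`_i]].

(* The rows of P are affinely independent iff the vectors (row i P, 1) are
   linearly independent. *)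
Definition aff_indep (R : realType) m n (P : 'M[R]_(m, n)) : bool :=
  row_free (row_mx P (const_mx 1 : 'cV_m)).

Definition has_dim (R : realType) n (A : set 'rV[R]_n) (d : nat) : Prop :=
  (exists P : 'M[R]_(d.+1, n), aff_indep P /\ forall i, A (row i P)) /\
  ~ (exists P : 'M[R]_(d.+2, n), aff_indep P /\ forall i, A (row i P)).

Definition lattice_polytope (R : realType) n (D : set 'rV[R]_n) : Prop :=
  exists s : seq 'rV[int]_n, D = conv [seq lat R z | z <- s].

Definition is_face (R : realType) n (D F : set 'rV[R]_n) : Prop :=
  exists (a : 'rV[R]_n) (b : R),
    (forall x, D x -> dot a x <= b) /\ F = D `&` [set x | dot a x = b].

(* Only used for D of dimension n >= 1. *)
Definition is_facet (R : realType) n (D F : set 'rV[R]_n) : Prop :=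
  is_face D F /\ has_dim F n.-1.

Definition is_simplex (R : realType) n (F : set 'rV[R]_n) : Prop :=
  exists m (P : 'M[R]_(m, n)),
    aff_indep P /\ F = conv [seq row i P | i <- enum 'I_m].

(* n lattice points whose translates by some u form a basis of Z^n are affinely
   independent, so they are the n vertices of F. *)
Definition unimodular_simplex (R : realType) n (F : set 'rV[R]_n) : Prop :=
  exists (w : n.-tuple 'rV[int]_n) (u : 'rV[int]_n),
    F = conv [seq lat R z | z <- w] /\
    (\matrix_(i < n) (tnth w i + u)) \in unitmx.

Definition toric_diagram (R : realType) n (D : set 'rV[R]_n) : Prop :=
  [/\ lattice_polytope D,
      has_dim D n,
      forall F, is_facet D F -> is_simplex F
    & forall F, is_facet D F -> unimodular_simplex F].

Definition unimod_equiv (R : realType) n (D D' : set 'rV[R]_n) : Prop :=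
  exists (A : 'M[int]_n) (u : 'rV[int]_n),
    A \in unitmx /\ D' = [set x *m map_mx intr A + lat R u | x in D].

Definition ehrhart (R : realType) n (D : set 'rV[R]_n) (t : nat) : nat :=
  #|` fset_set [set z : 'rV[int]_n | exists2 x, D x & lat R z = t%:R *: x] |.

(* h is the h*-vector of D, extended by zero to all integer indices.  For
   t > 0 and k <= n the truncated subtraction t + n - k is a true one. *)
Definition is_hstar (R : realType) n (D : set 'rV[R]_n) (h : int -> int) :
    Prop :=
  (forall j : int, (j < 0) || (n%:Z < j) -> h j = 0) /\
  (forall t : nat, (0 < t)%N ->
    (ehrhart D t)%:Z = \sum_(k < n.+1) h k%:Z * ('C(t + n - k, n))%:Z).

(* cb is the sequence of contact Betti numbers cb_* of the Gorenstein toric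
   contact manifold with toric diagram D. *)
Definition contact_betti (R : realType) n (D : set 'rV[R]_n)
    (cb : int -> nat) : Prop :=
  [/\ forall i : int, i < 0 -> cb i = 0%N,
      forall k : int, cb (2 * k + 1) = 0%N
    & exists2 h : int -> int, is_hstar D h &
        forall k : int,
          h (n%:Z - k) = (cb (2 * k))%:Z - (cb (2 * (k - 1)))%:Z].

(* Gorenstein toric contact manifolds of dimension 2n+1 are represented by
   their toric diagrams in R^n, and isomorphism of the former by unimodular
   equivalence of the latter.  The conditions in contact_betti determine cb,
   so cb below is the sequence of contact Betti numbers of D. *)
Definition rigid (R : realType) n (D : set 'rV[R]_n) : Prop :=
  exists2 cb : int -> nat, contact_betti D cb &
    forall D' : set 'rV[R]_n,
      toric_diagram D' -> contact_betti D' cb -> unimod_equiv D D'.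

(* The cone with defining normals (v, 1), v ranging over the vertices of D; by
   linearity all points v of D give the same cone. *)
Definition moment_cone (R : realType) n (D : set 'rV[R]_n) :
    set 'rV[R]_(n + 1) :=
  [set y | forall v, D v -> 0 <= dot y (row_mx v (const_mx 1))].

(* The moment cone of (the symplectization of) the prequantization of the toric
   symplectic manifold with moment polytope P. *)
Definition cone_over (R : realType) n (P : set 'rV[R]_n) :
    set 'rV[R]_(n + 1) :=
  [set y | exists (r : R) (x : 'rV[R]_n),
    [/\ 0 <= r, P x & y = r *: row_mx x (const_mx 1)]].

(* Toric contact manifolds are isomorphic iff their moment cones are related by
   GL(n+1, Z). *)
Definition prequantization_diagram (R : realType) n (P D : set 'rV[R]_n) :
    Prop :=
  exists2 A : 'M[int]_(n + 1), A \in unitmx &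
    moment_cone D = [set y *m map_mx intr A | y in cone_over P].

(* The moment polytope of (CP^1)^n with symplectic class c_1 / 2, where c_1 is
   2 pi times the integral first Chern class (as for the moment polytope
   [-1, 1]^n of the class c_1). *)
Definition unit_cube (R : realType) n : set 'rV[R]_n :=
  [set x : 'rV[R]_n | forall i, 0 <= x 0 i <= 1].

(* Indices start at 0: the vector usually written e_n is basis_vec n n.-1. *)
Definition basis_vec n (i : nat) : 'rV[int]_n :=
  \row_j ((j : nat) == i)%:R.

Definition small_cross_vertices n : seq 'rV[int]_n :=
  [:: 0; basis_vec n n.-1]
    ++ [seq basis_vec n i | i <- iota 0 n.-1]
    ++ [seq basis_vec n n.-1 - basis_vec n i | i <- iota 0 n.-1].

Definition small_cross (R : realType) n : set 'rV[R]_n :=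
  conv [seq lat R z | z <- small_cross_vertices n].

Arguments unit_cube R n : clear implicits.
Arguments small_cross R n : clear implicits.

(* Main.v *)
(** Write n = d + 1 and let D be a toric diagram with the Ehrhart function L of
    the small cross-polytope.  For a facet F of D let g_F be the primitive
    integral affine form that vanishes on F and is nonnegative on D.  As F is
    unimodular, every layer [g_F = const] of tD near F contains t^d/d! + o(t^d)
    lattice points, so moving the facet inequalities of tD by integers k_F
    changes its number of lattice points by - (sum_F k_F) t^d/d! + o(t^d).  With
    k_F = g_F(q) this evaluates L(t-1) - L(t), and sum_F g_F(q) = 2^d for every
    lattice point q; cutting 2tD into the classes of Z^n modulo 2 evaluates
    L(2t) - 2^n L(t), and D has 2^n facets.
    There are L(1) = 2n lattice points in D, n of them on each facet, so the sum
    of all g_F(q) forces g_F(q) to be 0 or 1.  Fix a facet with vertices v_i.  The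
    vectors (g_G(v_i))_i are pairwise distinct, hence run through {0,1}^n, and
    those G for which this is a unit vector match every v_i with a lattice point
    v'_i such that v_i + v'_i is constant.  So D is the convex hull of n antipodal
    pairs, in the same position with respect to Z^n as for the small
    cross-polytope. *)

(* In terms of volumes, sum_F g_F(q) = 2^d says that the signed pyramids with apex q over the facets
   fill D, since g_F(q) is the normalized volume of the pyramid over F and the h^*-vector (binomials
   C(d,k)) sums to 2^d. Likewise the second Ehrhart coefficient is half the normalized volume of the
   boundary, that is, half the number of facets up to the factor d!. Both facts are replaced here by
   comparing lattice counts up to o(t^d); multiplied by d!, all coefficients involved are integers.
   The combination L(2t) - 2^n L(t) cancels the term of degree n and so exposes the second
   coefficient. *)
From HB Require Import structures.
Require Import Defs.
From mathcomp Require Import all_boot all_order all_algebra finmap.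
From mathcomp Require Import boolp classical_sets functions cardinality reals.
From mathcomp Require Import zify ring lra.

Set Implicit Arguments.
Unset Strict Implicit.
Unset Printing Implicit Defensive.

Import Order.TTheory GRing.Theory Num.Theory.

Local Open Scope classical_set_scope.
Local Open Scope ring_scope.

(** * Cones and convex hulls *)

Section Cone.
Variables (R : realFieldType) (n : nat).

(** Peeling off one generator at a time fits the induction in [farkas]; [cone_sumP] recovers the
    usual sums. *)
Fixpoint cone (V : seq 'rV[R]_n) (x : 'rV[R]_n) : Prop :=
  if V is v :: V' then exists2 c : R, 0 <= c & cone V' (x - c *: v) else x = 0.

Implicit Types (V : seq 'rV[R]_n) (x y v : 'rV[R]_n) (l : 'cV[R]_n).

Lemma cone_nil x : cone [::] x = (x = 0). Proof. by []. Qed.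

Lemma cone_cons v V x :
  cone (v :: V) x = (exists2 c : R, 0 <= c & cone V (x - c *: v)).
Proof. by []. Qed.

Lemma cone0 V : cone V 0.
Proof.
elim: V => [|v V IH]; rewrite ?cone_nil ?cone_cons//.
by exists 0; rewrite // scale0r subr0.
Qed.

Lemma coneD V x y : cone V x -> cone V y -> cone V (x + y).
Proof.
elim: V x y => [|v V IH] x y; rewrite ?cone_nil ?cone_cons.
  by move=> -> ->; rewrite addr0.
move=> [a a0 Vx] [b b0 Vy]; exists (a + b); first exact: addr_ge0.
by rewrite scalerDl opprD addrACA; apply: IH.
Qed.

Lemma coneZ V a x : 0 <= a -> cone V x -> cone V (a *: x).
Proof.
move=> a0; elim: V x => [|v V IH] x; rewrite ?cone_nil ?cone_cons.
  by move=> ->; rewrite scaler0.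
move=> [b b0 Vx]; exists (a * b); first exact: mulr_ge0.
by rewrite -scalerA -scalerBr; apply: IH.
Qed.

Lemma cone_mem V v : v \in V -> cone V v.
Proof.
elim: V => // w V IH; rewrite inE cone_cons => /orP[/eqP->|/IH Vv].
  by exists 1; rewrite ?ler01// scale1r subrr; exact: cone0.
by exists 0; rewrite // scale0r subr0.
Qed.

Lemma cone_trans V V' x :
  (forall v, v \in V -> cone V' v) -> cone V x -> cone V' x.
Proof.
elim: V x => [|v V IH] x VV'; rewrite ?cone_nil ?cone_cons.
  by move=> ->; exact: cone0.
have V'v := VV' v (mem_head _ _); move=> [c c0 Vx].
rewrite -[x](subrK (c *: v)); apply: coneD; last exact: coneZ.
by apply: IH Vx => w Vw; apply: VV'; rewrite inE Vw orbT.
Qed.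

Lemma cone_ge0 V l x : (forall v, v \in V -> 0 <= (v *m l) 0 0) ->
  cone V x -> 0 <= (x *m l) 0 0.
Proof.
elim: V x => [|v V IH] x; rewrite ?cone_nil ?cone_cons.
  by move=> _ ->; rewrite mul0mx mxE.
move=> Vl [c c0 Vx]; rewrite -[x](subrK (c *: v)) mulmxDl -scalemxAl.
rewrite [X in 0 <= X]mxE; apply: addr_ge0; last first.
  by rewrite mxE mulr_ge0 ?Vl ?mem_head.
by apply: IH Vx => w Vw; apply: Vl; rewrite inE Vw orbT.
Qed.

Lemma cone_sumP V x :
  cone V x <-> exists2 c : 'I_(size V) -> R, forall i, 0 <= c i &
               x = \sum_i c i *: V`_i.
Proof.
elim: V x => [|v V IH] x; rewrite ?cone_nil ?cone_cons.
  split=> [->|[c _ ->]]; last by rewrite big_ord0.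
  by exists (fun=> 0) => //; rewrite big_ord0.
split=> [[a a0 /IH[c c0 xE]]|[c c0 ->]].
  exists (fun i => if unlift ord0 i is Some j then c j else a).
    by move=> i; case: unliftP.
  rewrite big_ord_recl unlift_none /= -[x](subrK (a *: v)) xE addrC.
  by congr (_ + _); apply: eq_bigr => i _; rewrite liftK.
exists (c ord0) => //; rewrite big_ord_recl /= addrC addKr.
by apply/IH; exists (fun i => c (lift ord0 i)).
Qed.

(* Separation by induction on the number of generators: if a functional [l]
   separating [x] from the cone of the tail is negative on the head [v], project
   along [v] onto the kernel of [l]. *)
Lemma farkas V x : ~ cone V x ->
  exists2 l : 'cV[R]_n, (forall v, v \in V -> 0 <= (v *m l) 0 0) &
                        (x *m l) 0 0 < 0.
Proof.
have [m mV] := ubnP (size V); elim: m => // m IHm in V x mV *.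
case: V mV => [|v V] mV nVx.
  have [j xj] : exists j, x 0 j != 0.
    apply/existsP; apply: contra_notT nVx => /existsPn x0.
    by apply/rowP => j; rewrite mxE; apply/eqP; have := x0 j; rewrite negbK.
  exists (- (x 0 j *: delta_mx j 0)) => //.
  rewrite mulmxN -scalemxAr -colE !mxE oppr_lt0.
  by rewrite lt_def mulf_neq0//= -expr2 sqr_ge0.
have [|l1 l1V l1x] := IHm V x mV.
  by move=> Vx; apply: nVx; rewrite cone_cons; exists 0; rewrite // scale0r subr0.
have [l1v|l1v] := leP 0 ((v *m l1) 0 0).
  by exists l1 => // w; rewrite inE => /orP[/eqP->|/l1V].
set a := (v *m l1) 0 0 in l1v.
pose A : 'M[R]_n := 1%:M - a^-1 *: (l1 *m v).
have AE y : y *m A = y - ((y *m l1) 0 0 / a) *: v.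
  rewrite mulmxBr mulmx1 -scalemxAr mulmxA.
  by rewrite {1}[y *m l1]mx11_scalar mul_scalar_mx scalerA mulrC.
have vA : v *m A = 0 by rewrite AE divff ?lt_eqF// scale1r subrr.
have [||l2 l2V l2x] := IHm [seq w *m A | w <- V] (x *m A).
- by rewrite size_map.
(* Both [(x *m l1) 0 0] and [a] are negative, so [x] is [x *m A] plus a nonnegative multiple of [v];
   each [w *m A] is [w] plus such a multiple. *)
- move=> VxA; apply: nVx; rewrite -[x](subrK (((x *m l1) 0 0 / a) *: v)) -AE.
  apply: coneD; last first.
    apply: coneZ; last by apply: cone_mem; rewrite mem_head.
    by rewrite ler_ndivlMr// mul0r ltW.
  apply: cone_trans VxA => _ /mapP[w Vw ->]; rewrite AE -scaleNr.
  apply: coneD; first by apply: cone_mem; rewrite inE Vw orbT.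
  apply: coneZ; last by apply: cone_mem; rewrite mem_head.
  by rewrite oppr_ge0 ler_ndivrMr// mul0r l1V.
exists (A *m l2); last by rewrite mulmxA.
move=> w; rewrite inE mulmxA => /orP[/eqP->|Vw].
  by rewrite vA mul0mx mxE.
by apply: l2V; apply/mapP; exists w.
Qed.

End Cone.

Section Convex.
Variables (R : realType) (n : nat).
Implicit Types (s : seq 'rV[R]_n) (x y : 'rV[R]_n) (l : 'cV[R]_(n + 1)).

Definition homog x : 'rV[R]_(n + 1) := row_mx x (const_mx 1).

Definition aff l x : R := (homog x *m l) 0 0.

Lemma affE (a : 'cV[R]_n) (b : R) x : aff (col_mx a b%:M) x = dot a^T x + b.
Proof.
rewrite /aff mul_row_col mxE; congr (_ + _).
  by rewrite mxE; apply: eq_bigr => i _; rewrite mxE mulrC.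
by rewrite mul_mx_scalar !mxE mulr1.
Qed.

Lemma aff_dot l x : aff l x = dot (usubmx l)^T x + dsubmx l 0 0.
Proof. by rewrite -{1}[l]vsubmxK {1}[dsubmx l]mx11_scalar affE mxE. Qed.

Lemma homog_comb (I : finType) (c : I -> R) (v : I -> 'rV[R]_n) :
  \sum_i c i = 1 -> homog (\sum_i c i *: v i) = \sum_i c i *: homog (v i).
Proof.
move=> c1; apply/rowP => j; rewrite summxE.
case: (split_ordP j) => k ->.
  by rewrite row_mxEl summxE; apply: eq_bigr => i _; rewrite [RHS]mxE row_mxEl mxE.
rewrite row_mxEr mxE -c1.
by apply: eq_bigr => i _; rewrite mxE row_mxEr mxE mulr1.
Qed.

Lemma homog_inj : injective homog.
Proof. by move=> x y /eq_row_mx[]. Qed.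

(** The last coordinate of [homog] is 1, so the weights of a conic combination equal to [homog x]
    sum to 1. *)
Lemma convP s x : conv s x <-> cone [seq homog v | v <- s] (homog x).
Proof.
have nthE i : (i < size s)%N -> [seq homog v | v <- s]`_i = homog s`_i.
  exact: nth_map.
have cast := size_map homog s.
split.
  move=> [c [c0 c1 ->]]; apply/cone_sumP; exists (c \o cast_ord cast).
    by move=> i; exact: c0.
  rewrite homog_comb// (reindex (cast_ord cast))/=; last first.
    by exists (cast_ord (esym cast)) => i _; rewrite ?cast_ordK ?cast_ordKV.
  by apply: eq_bigr => i _; rewrite /= nthE// -(size_map homog) ltn_ord.
move/cone_sumP => [c c0 xE].
pose c' := c \o cast_ord (esym cast).
have xE' : homog x = \sum_i c' i *: homog s`_i.
  rewrite xE (reindex (cast_ord (esym cast)))/=; last first.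
    by exists (cast_ord cast) => i _; rewrite ?cast_ordK ?cast_ordKV.
  by apply: eq_bigr => i _; rewrite /= nthE.
have c1 : \sum_i c' i = 1.
  have := congr1 (fun y : 'rV_(n + 1) => y 0 (rshift n 0)) xE'.
  rewrite row_mxEr mxE summxE => ->.
  by apply: eq_bigr => i _; rewrite mxE row_mxEr mxE mulr1.
exists c'; split=> //; first by move=> i; exact: c0.
by apply: homog_inj; rewrite homog_comb.
Qed.

Lemma conv_mem s x : x \in s -> conv s x.
Proof. by move=> sx; apply/convP/cone_mem/map_f. Qed.

Lemma conv_sub s s' : (forall v, v \in s -> conv s' v) -> conv s `<=` conv s'.
Proof.
move=> ss' x /convP sx; apply/convP; apply: cone_trans sx.
by move=> _ /mapP[v sv ->]; apply/convP/ss'.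
Qed.

Lemma conv_aff_ge0 s l x :
  (forall v, v \in s -> 0 <= aff l v) -> conv s x -> 0 <= aff l x.
Proof.
by move=> sl /convP sx; apply: (@cone_ge0 _ _ _ l _ _ sx) => _ /mapP[v sv ->]; exact: sl.
Qed.

Lemma conv_aff_eq0 s l x :
  (forall v, v \in s -> aff l v = 0) -> conv s x -> aff l x = 0.
Proof.
move=> sl sx; apply/eqP; rewrite eq_le -oppr_ge0.
have affN y : - aff l y = aff (- l) y by rewrite /aff mulmxN [RHS]mxE.
rewrite affN; apply/andP; split; apply: (conv_aff_ge0 _ sx) => v sv.
  by rewrite -affN sl ?oppr0.
by rewrite sl.
Qed.

Lemma conv_separation s x : ~ conv s x ->
  exists2 l, forall v, v \in s -> 0 <= aff l v & aff l x < 0.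
Proof.
move=> nsx; have [|l ls lx] := @farkas _ _ [seq homog v | v <- s] (homog x).
  by move/convP.
by exists l => // v sv; apply: ls; apply: map_f.
Qed.

Lemma row_homog m (P : 'M[R]_(m, n)) i :
  row i (row_mx P (const_mx 1 : 'cV_m)) = homog (row i P).
Proof. by rewrite row_row_mx row_const. Qed.

Lemma aff_indep_bound m (P : 'M[R]_(m, n)) l :
  l != 0 -> aff_indep P -> (forall i, aff l (row i P) = 0) -> (m <= n)%N.
Proof.
move=> l0 /eqP rP Pl; set H := row_mx P _ in rP.
have Hl : H *m l = 0.
  apply/row_matrixP => i; rewrite row_mul row_homog row0 [LHS]mx11_scalar.
  by rewrite -/(aff _ _) Pl raddf0.
have := mulmx0_rank_max Hl; have : (0 < \rank l)%N by rewrite lt0n mxrank_eq0.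
by rewrite rP; lia.
Qed.

Lemma dim_spans s : has_dim (conv s) n ->
  forall l, l != 0 -> exists2 v, v \in s & aff l v != 0.
Proof.
move=> [[P [rP sP]] _] l l0; apply: contrapT => /forall2NP sl.
suff : (n.+1 <= n)%N by lia.
apply: (aff_indep_bound l0 rP) => i; apply: conv_aff_eq0 (sP i) => v sv.
by have [//|/negP] := sl v; rewrite negbK => /eqP.
Qed.

End Convex.

(** * Facets of a polytope *)

Section Facets.
Variables (R : realType) (n : nat).
Implicit Types (s : seq 'rV[R]_n) (x y : 'rV[R]_n) (l m : 'cV[R]_(n + 1)).

Lemma affD l m x : aff (l + m) x = aff l x + aff m x.
Proof. by rewrite /aff mulmxDr [LHS]mxE. Qed.

Lemma affZ a l x : aff (a *: l) x = a * aff l x.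
Proof. by rewrite /aff -scalemxAr [LHS]mxE. Qed.

Lemma affN l x : aff (- l) x = - aff l x.
Proof. by rewrite /aff mulmxN [LHS]mxE. Qed.

(** For [l] nonnegative on [s] the rank is one more than the dimension of the face cut out by [l].
    The zero rows keep the shape independent of [l]. *)
Definition contact_mx s l : 'M[R]_(size s, n + 1) :=
  \matrix_i (if aff l s`_i == 0 then homog s`_i else 0).

(** A pivot: the contact points and [x] together have rank at most n, so some form [m] vanishes at
    all of them. Moving [l] along [m] keeps the contacts and the value at [x], until a further
    generator becomes tight. *)
Lemma contact_tighten s l x :
  (forall m, m != 0 -> exists2 v, v \in s & aff m v != 0) ->
  (forall v, v \in s -> 0 <= aff l v) -> aff l x < 0 ->
  (\rank (contact_mx s l) < n)%N ->
  exists l', [/\ forall v, v \in s -> 0 <= aff l' v, aff l' x < 0 &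
    (\rank (contact_mx s l) < \rank (contact_mx s l'))%N].
Proof.
move=> span_s sl lx; set Z := contact_mx s l => rZ.
have [m [m0 Zm mx]] : exists m, [/\ m != 0, Z *m m = 0 & aff m x = 0].
  pose Y := col_mx Z (homog x).
  have : cokermx Y != 0.
    rewrite cokermx_eq0 /row_full neq_ltn; apply/orP; left.
    have : (\rank Y <= \rank Z + \rank (homog x))%N.
      by rewrite -addsmxE mxrank_adds_leqif.
    by have := rank_leq_row (homog x); lia.
  case/matrix0Pn => i [j Cij]; exists (col j (cokermx Y)).
  have /eqP : Y *m col j (cokermx Y) = 0 by rewrite colE mulmxA mulmx_coker mul0mx.
  rewrite mul_col_mx col_mx_eq0 => /andP[/eqP Zm /eqP xm]; split=> //.
    by apply/matrix0Pn; exists i, 0; rewrite mxE.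
  by rewrite /aff xm mxE.
wlog [i0 mi0] : m m0 Zm mx / exists i : 'I_(size s), aff m s`_i < 0.
  have [v sv] := span_s _ m0.
  have [i is' <-] : exists2 i, (i < size s)%N & s`_i = v.
    by exists (index v s); rewrite ?index_mem ?nth_index.
  case: ltgtP => // mv _ Hw.
    by apply: (Hw m) => //; exists (Ordinal is').
  apply: (Hw (- m)) => //; rewrite ?oppr_eq0 ?mulmxN ?Zm ?affN ?mx ?oppr0//.
  by exists (Ordinal is'); rewrite affN oppr_lt0.
(* Ratio test: [rho i] is the step at which generator [i] becomes tight, and the smallest one keeps
   the form nonnegative on [s]. *)
pose rho (i : 'I_(size s)) := aff l s`_i / - aff m s`_i.
pose i1 := [arg min_(i < i0 | aff m s`_i < 0) rho i]%O.
have [mi1 min1] : aff m s`_i1 < 0 /\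
    forall i : 'I_(size s), aff m s`_i < 0 -> rho i1 <= rho i.
  by rewrite /i1; case: Order.TotalTheory.arg_minP.
have si (i : 'I_(size s)) : 0 <= aff l s`_i by apply/sl/mem_nth.
have r0 : 0 <= rho i1 by rewrite divr_ge0// oppr_ge0 ltW.
exists (l + rho i1 *: m); split.
- move=> v /[dup] sv; rewrite -index_mem => iv; rewrite -(nth_index 0 sv).
  have := si (Ordinal iv); have := min1 (Ordinal iv).
  rewrite affD affZ [rho (Ordinal iv)]/rho /=; set v' := s`_(index v s); move=> min1v lv.
  have [mv|mv] := leP 0 (aff m v'); first by rewrite addr_ge0// mulr_ge0.
  by have := min1v mv; rewrite ler_pdivlMr ?oppr_gt0// mulrN -subr_ge0 opprK addrC.
- by rewrite affD affZ mx mulr0 addr0.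
- set Z' := contact_mx s _; apply: rank_ltmx.
  have rowm i : row i Z *m m = 0 by rewrite -row_mul Zm row0.
  apply/andP; split.
    apply/row_subP => i; rewrite rowK; case: eqP => li; last exact: sub0mx.
    have mi : aff m s`_i = 0.
      by have := rowm i; rewrite rowK li eqxx /aff => ->; rewrite mxE.
    suff -> : homog s`_i = row i Z' by exact: row_sub.
    by rewrite rowK affD affZ li mi mulr0 addr0 eqxx.
  apply: contraL (mi1) => /submxP[D Z'E]; rewrite -leNgt.
  suff -> : aff m s`_i1 = 0 by [].
  have : row i1 Z' *m m = 0 by rewrite -row_mul Z'E -mulmxA Zm mulmx0 row0.
  have nz : aff m s`_i1 != 0 by rewrite lt_eqF.
  rewrite rowK affD affZ /rho -mulrA invrN mulNr mulVf // mulrN1 subrr eqxx.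
  by rewrite /aff => ->; rewrite mxE.
Qed.

Lemma contact_maximal s x :
  (forall m, m != 0 -> exists2 v, v \in s & aff m v != 0) -> ~ conv s x ->
  exists l, [/\ forall v, v \in s -> 0 <= aff l v, aff l x < 0 &
    (n <= \rank (contact_mx s l))%N].
Proof.
move=> span_s /conv_separation[l0 sl0 l0x].
suff H k : (k <= n)%N -> exists l, [/\ forall v, v \in s -> 0 <= aff l v,
    aff l x < 0 & (k <= \rank (contact_mx s l))%N] by exact: H.
elim: k => [_|k IH kn]; first by exists l0.
have [l [sl lx]] := IH (ltnW kn); rewrite leq_eqVlt => /orP[/eqP rk|kr].
  by have [|l' []] := contact_tighten span_s sl lx; rewrite -rk//; exists l'.
by exists l.
Qed.

Lemma is_face_aff (D F : set 'rV[R]_n) :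
  is_face D F <-> exists l, (forall x, D x -> 0 <= aff l x) /\
                            F = D `&` [set x | aff l x = 0].
Proof.
split=> [[a [b [Db ->]]]|[l [Dl ->]]].
  have E x : aff (col_mx (- a^T) b%:M) x = b - dot a x.
    rewrite affE addrC; congr (_ + _).
    by rewrite /dot -sumrN; apply: eq_bigr => i _; rewrite !mxE mulNr.
  exists (col_mx (- a^T) b%:M); split=> [x Dx|].
    by rewrite E subr_ge0 Db.
  apply/seteqP; split=> x [Dx] /=; rewrite E.
    by move=> ->; rewrite subrr.
  by move/eqP; rewrite subr_eq0 => /eqP.
have E x : dot (- (usubmx l)^T) x = dsubmx l 0 0 - aff l x.
  rewrite aff_dot opprD addrCA subrr addr0 /dot -sumrN.
  by apply: eq_bigr => i _; rewrite !mxE mulNr.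
exists (- (usubmx l)^T), (dsubmx l 0 0); split=> [x Dx|].
  by rewrite E lerBlDr lerDl Dl.
apply/seteqP; split=> x [Dx] /=; rewrite E.
  by move=> ->; rewrite subr0.
by move/eqP; rewrite addrC -subr_eq0 addrK oppr_eq0 => /eqP.
Qed.

End Facets.

Lemma contact_facet (R : realType) d (s : seq 'rV[R]_d.+1)
    (l : 'cV[R]_(d.+1 + 1)) :
  l != 0 -> (forall v, v \in s -> 0 <= aff l v) ->
  (d.+1 <= \rank (contact_mx s l))%N ->
  is_facet (conv s) (conv s `&` [set y | aff l y = 0]).
Proof.
move=> l0 sl; set Z := contact_mx s l => rZ; split.
  by apply/is_face_aff; exists l; split=> // x; exact: conv_aff_ge0.
split; last first.
  move=> [P [rP DP]]; have : (d.+2 <= d.+1)%N; last by rewrite ltnn.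
  by apply: (aff_indep_bound l0 rP) => i; case: (DP i).
have Zl : Z *m l = 0.
  apply/row_matrixP => i; rewrite row_mul row0 rowK.
  case: eqP => li; last by rewrite mul0mx.
  by rewrite [LHS]mx11_scalar -/(aff _ _) li raddf0.
have {}rZ : \rank Z = d.+1.
  apply/eqP; rewrite eqn_leq rZ andbT.
  have := mulmx0_rank_max Zl; have : (0 < \rank l)%N by rewrite lt0n mxrank_eq0.
  by rewrite /=; lia.
have [f fZ] : exists f : 'I_d.+1 -> 'I_(size s), row_free (rowsub f Z).
  (* [\rank Z] occurs in the type of [maxrankfun Z]; a variable [k] lets it be replaced by
     [d.+1]. *)
  have H k : \rank Z = k -> exists f : 'I_k -> 'I_(size s), row_free (rowsub f Z).
    by move=> <-; exists (maxrankfun Z); exact: maxrowsub_free.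
  exact: H.
(* Rows of a row-free matrix are nonzero, so the selected ones are genuine contact points and not
   zero fillers. *)
have fE i : row i (rowsub f Z) = homog s`_(f i) /\ aff l s`_(f i) = 0.
  have : row i (rowsub f Z) != 0.
    apply/negP => /eqP ri; case/row_freeP: fZ => B /(congr1 (row i)).
    rewrite row_mul ri mul0mx => /rowP/(_ i)/eqP.
    by rewrite !mxE eqxx eq_sym oner_eq0.
  by rewrite row_rowsub rowK; case: ifP => [/eqP/= ->|_] //; rewrite eqxx.
exists (\matrix_i s`_(f i)); split.
  rewrite /aff_indep; suff -> : row_mx (\matrix_i s`_(f i)) (const_mx 1 : 'cV_d.+1) =
      rowsub f Z by [].
  by apply/row_matrixP => i; rewrite row_homog rowK; case: (fE i).
move=> i; rewrite rowK; split; last by case: (fE i).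
by apply: conv_mem; apply: mem_nth.
Qed.

Lemma facet_separation (R : realType) d (s : seq 'rV[R]_d.+1) (x : 'rV_d.+1) :
  has_dim (conv s) d.+1 -> ~ conv s x ->
  exists l : 'cV[R]_(d.+1 + 1), [/\ forall y, conv s y -> 0 <= aff l y,
    aff l x < 0 & is_facet (conv s) (conv s `&` [set y | aff l y = 0])].
Proof.
move=> /dim_spans span_s nsx; have [l [sl lx rl]] := contact_maximal span_s nsx.
exists l; split=> //; first by move=> y; exact: conv_aff_ge0.
apply: contact_facet => //; apply: contraTneq lx => ->.
by rewrite /aff mulmx0 mxE ltxx.
Qed.

(** * Integral facet forms *)

Section IntegralForms.
Variable n : nat.
Implicit Types (f : 'cV[int]_n * int) (t : int) (z u : 'rV[int]_n).

(* [(a, b)] stands for the linear form [(z, t) |-> t b - z a] on Z^n x Z. *)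
Definition ev f t z : int := t * f.2 - (z *m f.1) 0 0.

Lemma evD f t t' z z' : ev f (t + t') (z + z') = ev f t z + ev f t' z'.
Proof. by rewrite /ev mulmxDl [X in _ - X]mxE; ring. Qed.

Lemma evN f t z : ev f (- t) (- z) = - ev f t z.
Proof. by rewrite /ev mulNmx [X in _ - X]mxE; ring. Qed.

Lemma evB f t t' z z' : ev f (t - t') (z - z') = ev f t z - ev f t' z'.
Proof. by rewrite evD evN. Qed.

Lemma evZ f a t z : ev f (a * t) (a *: z) = a * ev f t z.
Proof. by rewrite /ev -scalemxAl [X in _ - X]mxE; ring. Qed.

Lemma ev0 f : ev f 0 0 = 0.
Proof. by rewrite /ev mul0mx mxE mul0r subr0. Qed.

Lemma ev_sum f (I : Type) (r : seq I) (P : pred I) (t : I -> int)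
    (z : I -> 'rV[int]_n) :
  ev f (\sum_(i <- r | P i) t i) (\sum_(i <- r | P i) z i) =
  \sum_(i <- r | P i) ev f (t i) (z i).
Proof.
by elim/big_rec3: _ => [|i y1 y2 y3 _ <-]; rewrite ?ev0 ?evD.
Qed.

Definition csum (c : 'rV[int]_n) : int := \sum_i c 0 i.

Lemma csumE c : csum c = (c *m const_mx 1 : 'M_1) 0 0.
Proof. by rewrite mxE; apply: eq_bigr => i _; rewrite mxE mulr1. Qed.

Lemma csumD c c' : csum (c + c') = csum c + csum c'.
Proof. by rewrite /csum -big_split; apply: eq_bigr => i _; rewrite mxE. Qed.

Lemma csumZ a c : csum (a *: c) = a * csum c.
Proof. by rewrite /csum mulr_sumr; apply: eq_bigr => i _; rewrite mxE. Qed.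

(* The form that vanishes at the points [w_i], where the [w_i + u] are the rows
   of the unimodular matrix [M]. *)
Definition simplex_form (e : int) (M : 'M[int]_n) u : 'cV[int]_n * int :=
  (e *: (invmx M *m const_mx 1), e * (1 - csum (u *m invmx M))).

Lemma ev_simplex_form e M u t z :
  ev (simplex_form e M u) t z = e * (t - csum ((z + t *: u) *m invmx M)).
Proof.
rewrite /ev /= -scalemxAr [X in _ - X]mxE mulmxA -csumE mulmxDl -scalemxAl.
by rewrite csumD csumZ; ring.
Qed.

End IntegralForms.

Section RealForms.
Variables (R : realType) (n : nat).
Implicit Types (f : 'cV[int]_n * int) (x : 'rV[R]_n).

Definition real_form f : 'cV[R]_(n + 1) :=
  col_mx (- map_mx intr f.1) (f.2%:~R)%:M.

Lemma aff_real_form f x :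
  aff (real_form f) x = f.2%:~R - (x *m map_mx intr f.1) 0 0.
Proof.
rewrite /aff mul_row_col mul_mx_scalar mulmxN [LHS]mxE addrC.
by congr (_ + _); rewrite [LHS]mxE ?mxE ?mulr1.
Qed.

Lemma aff_real_form_ev f (t : int) z x : lat R z = t%:~R *: x ->
  (ev f t z)%:~R = t%:~R * aff (real_form f) x.
Proof.
move=> zx; rewrite aff_real_form mulrBr /ev intrB intrM; congr (_ - _).
have -> : t%:~R * (x *m map_mx intr f.1) 0 0 = (lat R z *m map_mx intr f.1) 0 0.
  by rewrite zx -scalemxAl [RHS]mxE.
by rewrite /lat -map_mxM [RHS]mxE.
Qed.

Lemma aff_real_form_lat f z : aff (real_form f) (lat R z) = (ev f 1 z)%:~R.
Proof. by rewrite (@aff_real_form_ev _ _ _ (lat R z)) ?scale1r// mul1r. Qed.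

Lemma conv_tupleP (m : nat) (w : m.-tuple 'rV[int]_n) x :
  conv [seq lat R z | z <- w] x <-> exists c : 'rV[R]_m,
    [/\ forall i, 0 <= c 0 i, \sum_i c 0 i = 1 &
        x = c *m map_mx intr (\matrix_i tnth w i)].
Proof.
have sz : size [seq lat R z | z <- w] = m by rewrite size_map size_tuple.
have E (c : 'I_(size [seq lat R z | z <- w]) -> R) :
    \sum_i c i *: [seq lat R z | z <- w]`_i =
    (\row_i c (cast_ord (esym sz) i)) *m map_mx intr (\matrix_i tnth w i).
  rewrite (reindex (cast_ord (esym sz)))/=; last first.
    by exists (cast_ord sz) => i _; rewrite ?cast_ordK ?cast_ordKV.
  rewrite mulmx_sum_row; apply: eq_bigr => i _; rewrite mxE; congr (_ *: _).
  rewrite (nth_map 0) ?size_tuple// -map_row rowK (tnth_nth 0) //.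
split=> [[c [c0 c1 ->]]|[c [c0 c1 ->]]].
  exists (\row_i c (cast_ord (esym sz) i)); split; last exact: E.
    by move=> i; rewrite mxE.
  rewrite -c1 [RHS](reindex (cast_ord (esym sz)))/=; last first.
    by exists (cast_ord sz) => i _; rewrite ?cast_ordK ?cast_ordKV.
  by apply: eq_bigr => i _; rewrite mxE.
exists (fun i => c 0 (cast_ord sz i)); split=> //.
  rewrite -c1 [RHS](reindex (cast_ord sz))//=.
  by exists (cast_ord (esym sz)) => i _; rewrite ?cast_ordK ?cast_ordKV.
rewrite E; congr (_ *m _); apply/rowP => i; rewrite mxE.
by rewrite cast_ordKV.
Qed.

End RealForms.

Section FacetForm.
Variables (R : realType) (d : nat).
Local Notation n := d.+1.
Implicit Types (D F : set 'rV[R]_n) (w : n.-tuple 'rV[int]_n) (u : 'rV[int]_n).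

Lemma csum_lat m (c : 'rV[int]_m) :
  (csum c)%:~R = (lat R c *m const_mx 1 : 'M_1) 0 0.
Proof. by rewrite mxE rmorph_sum; apply: eq_bigr => i _; rewrite !mxE mulr1. Qed.

Lemma aff_simplex_form e (M : 'M[int]_n) u (x : 'rV[R]_n) :
  aff (real_form R (simplex_form e M u)) x =
  e%:~R * (1 - ((x + lat R u) *m map_mx intr (invmx M) *m const_mx 1 : 'M_1) 0 0).
Proof.
rewrite aff_real_form /= intrM intrB csum_lat /lat map_mxM.
rewrite map_mxZ map_mxM map_const_mx -scalemxAr [X in _ - X]mxE mulmxA.
by rewrite mulmxDl mulmxDl [X in _ = _ * (1 - X)]mxE; ring.
Qed.

(** The linear part of [l] takes one value [k] on all the [w_i + u]. These form a basis, so [l] is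
    determined up to scale, and the sign [e] absorbs the sign of [k]. *)
Lemma facet_form D (l : 'cV[R]_(n + 1)) w u : has_dim D n ->
  (forall x, D x -> 0 <= aff l x) ->
  has_dim (D `&` [set x | aff l x = 0]) d ->
  D `&` [set x | aff l x = 0] = conv [seq lat R z | z <- w] ->
  (\matrix_(i < n) (tnth w i + u)) \in unitmx ->
  exists e : int, exists2 k : R, (e = 1 \/ e = -1) /\ 0 < k & forall x,
    aff l x = k * aff (real_form R (simplex_form e (\matrix_i (tnth w i + u)) u)) x.
Proof.
set F := D `&` _; move=> [dimD _] Dl [_ dimF] Fw; set M := \matrix_i _ => uM.
have wl i : aff l (lat R (tnth w i)) = 0.
  have : F (lat R (tnth w i)) by rewrite Fw; apply/conv_mem/map_f/mem_tnth.
  by case.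
pose M' : 'M[R]_n := map_mx intr (invmx M).
have M'M : M' *m map_mx intr M = 1%:M by rewrite -map_mxM mulVmx// map_mx1.
pose a := usubmx l; pose b := dsubmx l 0 0.
have lE x : aff l x = (x *m a) 0 0 + b.
  rewrite aff_dot; congr (_ + _); rewrite /dot mxE.
  by apply: eq_bigr => i _; rewrite mxE mulrC.
pose k := (lat R u *m a) 0 0 - b.
have Ma : map_mx intr M *m a = k *: (const_mx 1 : 'cV_n).
  apply/colP => i; rewrite [RHS]mxE [X in _ = _ * X]mxE mulr1.
  have := wl i; rewrite lE => /eqP; rewrite addr_eq0 => /eqP wa.
  transitivity ((lat R (tnth w i + u) *m a) 0 0).
    by rewrite mxE [RHS]mxE; apply: eq_bigr => j _; rewrite !mxE.
  by rewrite /lat map_mxD mulmxDl [LHS]mxE wa addrC.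
have aE : a = k *: (M' *m const_mx 1) by rewrite scalemxAr -Ma mulmxA M'M mul1mx.
have lk x : aff l x = - k * (1 - ((x + lat R u) *m M' *m const_mx 1 : 'M_1) 0 0).
  rewrite lE -[b](subKr ((lat R u *m a) 0 0)) -/k addrA.
  have -> : (x *m a) 0 0 + (lat R u *m a) 0 0 = ((x + lat R u) *m a) 0 0.
    by rewrite mulmxDl [RHS]mxE.
  by rewrite aE -scalemxAr [X in X - _]mxE mulmxA; ring.
(* Otherwise [l] vanishes on [D] and the facet is all of [D], of too large a dimension. *)
have k0 : k != 0.
  apply/eqP => k0; apply: dimF; suff -> : F = D by [].
  by apply/seteqP; split=> [x []//|x Dx]; split=> //=; rewrite lk k0 oppr0 mul0r.
exists (if k < 0 then 1 else -1), `|k|; last first.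
  move=> x; rewrite lk aff_simplex_form mulrA; congr (_ * _).
  by case: ltrgt0P k0 => // _ _; rewrite ?mulr1 ?mulrN1.
by split; [case: ifP; [left|right]|rewrite normr_gt0].
Qed.

(** [c] and t times the barycentric coordinates of [x] have the same sum and the same combination of
    the [w_i], hence of the [w_i + u]. The latter are independent, so the two vectors agree. *)
Lemma simplex_coords w u (c : 'rV[int]_n) (t : int) : csum c = t ->
  (\matrix_(i < n) (tnth w i + u)) \in unitmx -> 0 < t ->
  forall x, lat R (c *m \matrix_i tnth w i) = t%:~R *: x ->
  conv [seq lat R z | z <- w] x -> forall i, 0 <= c 0 i.
Proof.
move=> ct; set M := \matrix_i _ => uM t0 x cx /conv_tupleP[b [b0 b1 xE]] i.
pose M' : 'M[R]_n := map_mx intr (invmx M).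
have MM' : map_mx intr M *m M' = 1%:M by rewrite -map_mxM mulmxV// map_mx1.
pose W : 'M[int]_n := \matrix_i tnth w i.
have ME : M = W + (const_mx 1 : 'cV_n) *m u.
  by apply/matrixP => j k; rewrite !mxE big_ord1 !mxE mul1r.
have : (map_mx intr c - t%:~R *: b) *m map_mx intr M = 0.
  have b1' : b *m const_mx 1 = 1%:M :> 'M_1.
    rewrite [LHS]mx11_scalar mxE; under eq_bigr do rewrite [X in _ * X]mxE mulr1.
    by rewrite b1.
  have ct' : map_mx intr c *m const_mx 1 = t%:~R%:M :> 'M[R]_1.
    by rewrite [LHS]mx11_scalar -[X in X%:M]csum_lat ct.
  rewrite ME map_mxD mulmxDr mulmxBl -map_mxM -[X in X - _]/(lat R _) cx xE.
  rewrite -scalemxAl subrr add0r map_mxM map_const_mx rmorph1 mulmxA mulmxBl.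
  by rewrite -scalemxAl b1' ct' scalemx1 subrr mul0mx.
move/(congr1 (mulmx^~ M')); rewrite -mulmxA MM' mulmx1 mul0mx => /rowP/(_ i).
rewrite !mxE => /eqP; rewrite subr_eq0 => /eqP cb.
by rewrite -(ler0z R) cb mulr_ge0// ler0z ltW.
Qed.

End FacetForm.

(** * Leading asymptotics and counting *)

Section Leading.
Variable d : nat.
Implicit Types (u v : nat -> int) (c : int).

(* [u t = c t^d + o(t^d)], stated without division *)
Definition lead u c : Prop := forall m : nat, exists T : nat, forall t : nat,
  (T <= t)%N -> m%:Z * `|u t - c * t%:Z ^+ d| <= t%:Z ^+ d.

Lemma lead_eventually u v c (T : nat) :
  (forall t, (T <= t)%N -> u t = v t) -> lead u c -> lead v c.
Proof.
move=> uv uc m; have [T' H] := uc m; exists (maxn T T') => t.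
by rewrite geq_max => /andP[Tt T't]; rewrite -uv// H.
Qed.

Lemma leadD u v a b : lead u a -> lead v b -> lead (fun t => u t + v t) (a + b).
Proof.
move=> ua vb m; have [T1 H1] := ua (2 * m)%N; have [T2 H2] := vb (2 * m)%N.
exists (maxn T1 T2) => t; rewrite geq_max => /andP[/H1 {}H1 /H2 {}H2].
have -> : u t + v t - (a + b) * t%:Z ^+ d =
  (u t - a * t%:Z ^+ d) + (v t - b * t%:Z ^+ d) by ring.
set x := u t - _ in H1 *; set y := v t - _ in H2 *.
have : m%:Z * `|x + y| <= m%:Z * (`|x| + `|y|) by rewrite ler_wpM2l ?ler_normD.
by rewrite PoszM in H1 H2; lia.
Qed.

Lemma leadZ k u c : lead u c -> lead (fun t => k * u t) (k * c).
Proof.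
move=> uc m; have [T H] := uc (m * `|k|)%N; exists T => t /H.
by rewrite -mulrA -mulrBr normrM PoszM abszE mulrA.
Qed.

Lemma leadN u c : lead u c -> lead (fun t => - u t) (- c).
Proof.
move/(leadZ (-1)); rewrite mulN1r; apply: (@lead_eventually _ _ _ 0) => t _.
by rewrite mulN1r.
Qed.

Lemma lead0 : lead (fun=> 0) 0.
Proof. by move=> m; exists 0%N => t _; rewrite mul0r subrr normr0 mulr0 exprn_ge0. Qed.

Lemma lead_sum (I : Type) (r : seq I) (u : I -> nat -> int) (c : I -> int) :
  (forall i, lead (u i) (c i)) ->
  lead (fun t => \sum_(i <- r) u i t) (\sum_(i <- r) c i).
Proof.
move=> uc; elim: r => [|i r IH].
  by rewrite big_nil; apply: (@lead_eventually _ _ _ 0 _ lead0) => t _; rewrite big_nil.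
rewrite big_cons; apply: (@lead_eventually _ _ _ 0 _ (leadD (uc i) IH)) => t _.
by rewrite big_cons.
Qed.

Lemma lead_unique u a b : lead u a -> lead u b -> a = b.
Proof.
(* Two errors of at most a quarter of t^d cannot make up [(a - b) t^d], which is at least t^d in
   absolute value when a and b differ. *)
move=> /(_ 4%N)[T1 H1] /(_ 4%N)[T2 H2].
have := H1 (maxn T1 (maxn T2 1)); have := H2 (maxn T1 (maxn T2 1)).
rewrite !leq_max !leqnn !orbT => /(_ isT); set t := maxn _ _.
move=> h2 /(_ isT) h1.
have t0 : 0 < t%:Z ^+ d by rewrite exprn_gt0// ltz_nat !leq_max !orbT.
apply/eqP; rewrite -subr_eq0; apply/negPn/negP => ab.
have : t%:Z ^+ d <= `|(a - b) * t%:Z ^+ d|.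
  by rewrite normrM (gtr0_norm t0) ler_peMl ?(ltW t0)//; move: ab; lia.
have -> : (a - b) * t%:Z ^+ d = (u t - b * t%:Z ^+ d) - (u t - a * t%:Z ^+ d) by ring.
by move: h1 h2 t0; lia.
Qed.

Lemma lead_squeeze u v w c :
  (exists T : nat, forall t, (T <= t)%N -> u t <= v t <= w t) ->
  lead u c -> lead w c -> lead v c.
Proof.
move=> [T0 uvw] uc wc m; have [T1 H1] := uc m; have [T2 H2] := wc m.
exists (maxn T0 (maxn T1 T2)) => t; rewrite !geq_max => /and3P[/uvw/andP[uv vw]].
move=> /H1 {}H1 /H2 {}H2; set x := c * _ in H1 H2 *.
have [xv|xv] := leP 0 (v t - x).
  by apply: le_trans H2; rewrite ler_wpM2l//; lia.
by apply: le_trans H1; rewrite ler_wpM2l//; lia.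
Qed.

Lemma lead_poly (p : {poly int}) : (size p <= d.+1)%N ->
  lead (fun t => p.[t%:Z]) p`_d.
Proof.
move=> sp m; pose A := \sum_(i < d) `|p`_i|.
have A0 : 0 <= A by rewrite sumr_ge0.
exists (maxn 1 (m * `|A|)) => t; rewrite geq_max => /andP[t1 tA].
have {}t1 : 1 <= t%:Z by rewrite lez_nat.
rewrite (horner_coef_wide _ sp) big_ord_recr /= addrK.
(* The factor t on the left avoids the exponent d - 1, so that d = 0 needs no separate case. *)
have H : `|\sum_(i < d) p`_i * t%:Z ^+ i| * t%:Z <= A * t%:Z ^+ d.
  rewrite -[_ * t%:Z]ger0_norm ?mulr_ge0 ?normr_ge0 ?(le_trans _ t1)//.
  rewrite normrM normr_id -normrM mulr_suml /A mulr_suml.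
  apply: (le_trans (ler_norm_sum _ _ _)); apply: ler_sum => i _.
  rewrite -mulrA -exprSr normrM ler_wpM2l// ger0_norm ?exprn_ge0 ?(le_trans _ t1)//.
  by rewrite ler_weXn2l.
have t0 : 0 < t%:Z by apply: lt_le_trans t1.
rewrite -(ler_pM2r t0) -mulrA; apply: (le_trans (ler_wpM2l _ H)) => //.
rewrite mulrA mulrC ler_wpM2l ?exprn_ge0//.
by move: tA A0; rewrite -lez_nat PoszM; lia.
Qed.

End Leading.

Section Counting.
Implicit Types (T U : choiceType).

Definition cnt T (A : set T) : nat := #|` fset_set A|.

Lemma cnt_inj T U (A : set T) (B : set U) (g : T -> U) :
  finite_set A -> finite_set B -> (forall x, A x -> B (g x)) ->
  (forall x y, A x -> A y -> g x = g y -> x = y) -> (cnt A <= cnt B)%N.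
Proof.
move=> fA fB AB gI.
rewrite /cnt -(card_in_imfset (f := g) imfset_key (p := mem (fset_set A)))/=.
  apply: fsubset_leq_card; apply/fsubsetP => _ /imfsetP[x + ->].
  by rewrite /= !in_fset_set// !inE; exact: AB.
by move=> x y /=; rewrite !in_fset_set// !inE; exact: gI.
Qed.

Lemma cnt_bij T U (A : set T) (B : set U) (g : T -> U) (h : U -> T) :
  finite_set A -> finite_set B ->
  (forall x, A x -> B (g x)) -> (forall y, B y -> A (h y)) ->
  (forall x, A x -> h (g x) = x) -> (forall y, B y -> g (h y) = y) ->
  cnt A = cnt B.
Proof.
move=> fA fB AB BA hK gK; apply/eqP; rewrite eqn_leq; apply/andP; split.
  apply: (cnt_inj (g := g)) => // x y Ax Ay /(congr1 h); by rewrite !hK.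
apply: (cnt_inj (g := h)) => // x y Bx By /(congr1 g); by rewrite !gK.
Qed.

Lemma cnt_imset (I : finType) T (A : {set I}) (g : I -> T) (B : set T) :
  {in A &, injective g} -> (forall i, i \in A -> B (g i)) ->
  (forall x, B x -> exists2 i, i \in A & x = g i) ->
  finite_set B /\ cnt B = #|A|.
Proof.
move=> gI AB BA; have BE : B = [set` [fset g i | i in A]%fset].
  apply/seteqP; split=> [x /BA[i Ai ->]|_ /imfsetP[i Ai ->]]; last exact: AB.
  by apply/imfsetP; exists i.
split; first by rewrite BE; exact: finite_fset.
by rewrite /cnt BE set_fsetK card_in_imfset//= cardE; congr (size _); apply: eq_enum.
Qed.

Lemma cnt_split T (A : set T) (P : pred T) : finite_set A ->
  (cnt A = cnt (A `&` [set x | P x]) + cnt (A `&` [set x | ~~ P x]))%N.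
Proof.
move=> fA; rewrite /cnt -cardfsUI -fset_setI -?fset_setU; [|exact: finite_setIl..].
set B := A `&` _; set C := A `&` _.
have -> : B `&` C = set0.
  by rewrite -subset0 => x [[_ /= Px] [_ /=]]; rewrite Px.
have -> : B `|` C = A.
  apply/seteqP; split=> [x [[]|[]]//|x Ax]; rewrite /B /C /=.
  by case: (P x); [left|right].
by rewrite fset_set0 cardfs0 addn0.
Qed.

Lemma cnt_partition T (I : finType) (A : set T) (g : T -> I) : finite_set A ->
  cnt A = (\sum_i cnt (A `&` [set x | g x = i]))%N.
Proof.
move=> fA; rewrite /cnt -sum1_size (partition_big g xpredT)//=.
apply: eq_bigr => i _; rewrite sum1_count -size_filter.
apply/perm_size/uniq_perm; rewrite ?filter_uniq ?fset_uniq// => x.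
rewrite mem_filter !in_fset_set//; last exact: finite_setIl.
by rewrite in_setI andbC; congr (_ && _); apply/eqP/idP; rewrite inE.
Qed.

End Counting.

Section LatticeSimplex.

Lemma cnt_dilated_simplex n T (A := [set c : 'rV[int]_n |
    (forall i, 0 <= c 0 i) /\ csum c <= T%:Z]) :
  finite_set A /\ cnt A = 'C(n + T, n).
Proof.
pose g (t : n.-tuple 'I_T.+1) : 'rV[int]_n := \row_i (tnth t i : nat)%:Z.
have gtot t : csum (g t) = (\sum_(i <- t) i)%:Z.
  rewrite big_tuple /csum; under eq_bigr do rewrite mxE.
  by elim/big_rec2: _ => // i y1 y2 _ ->; rewrite PoszD.
rewrite -card_partial_ord_partitions; apply: (cnt_imset (g := g)).
- move=> s t _ _ /rowP st; apply: eq_from_tnth => i; apply: val_inj.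
  by have := st i; rewrite !mxE => -[].
- by move=> t; rewrite inE => tT; split; [move=> i; rewrite mxE|rewrite gtot].
move=> c [c0 cT].
have cb i : (`|(c 0 i)%R| < T.+1)%N.
  have : c 0 i <= csum c by rewrite /csum (bigD1 i)//= lerDl sumr_ge0.
  by rewrite ltnS -lez_nat gez0_abs// => /le_trans; apply.
have cE : c = g [tuple Ordinal (cb i) | i < n].
  by apply/rowP => i; rewrite mxE tnth_mktuple /= gez0_abs.
by exists [tuple Ordinal (cb i) | i < n] => //; rewrite inE -lez_nat -gtot -cE.
Qed.

Lemma cnt_dilated_face d T (A := [set c : 'rV[int]_d.+1 |
    (forall i, 0 <= c 0 i) /\ csum c = T%:Z]) :
  finite_set A /\ cnt A = 'C(d + T, d).
Proof.
pose g (t : d.+1.-tuple 'I_T.+1) : 'rV[int]_d.+1 := \row_i (tnth t i : nat)%:Z.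
have gtot t : csum (g t) = (\sum_(i <- t) i)%:Z.
  rewrite big_tuple /csum; under eq_bigr do rewrite mxE.
  by elim/big_rec2: _ => // i y1 y2 _ ->; rewrite PoszD.
rewrite -card_ord_partitions; apply: (cnt_imset (g := g)).
- move=> s t _ _ /rowP st; apply: eq_from_tnth => i; apply: val_inj.
  by have := st i; rewrite !mxE => -[].
- by move=> t; rewrite inE => /eqP tT; split; [move=> i; rewrite mxE|rewrite gtot tT].
move=> c [c0 cT].
have cb i : (`|(c 0 i)%R| < T.+1)%N.
  have : c 0 i <= csum c by rewrite /csum (bigD1 i)//= lerDl sumr_ge0.
  by rewrite ltnS -lez_nat gez0_abs// -cT.
have cE : c = g [tuple Ordinal (cb i) | i < d.+1].
  by apply/rowP => i; rewrite mxE tnth_mktuple /= gez0_abs.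
by exists [tuple Ordinal (cb i) | i < d.+1] => //; rewrite inE -eqz_nat -gtot -cE cT.
Qed.


End LatticeSimplex.

(** * Lattice points near the facets *)

Lemma fact_binomial_prod (d m : nat) : (d <= m)%N ->
  (d`! * 'C(m, d))%N%:Z = \prod_(i < d) (m%:Z - i%:Z).
Proof.
move=> dm; rewrite mulnC bin_ffact ffact_prod.
rewrite (big_morph Posz PoszM (erefl _)); apply: eq_bigr => i _.
by rewrite -subzn// ltnW// (leq_trans (ltn_ord i)).
Qed.

(** Once t + K >= d this is a monic polynomial of degree d in t; the factorial keeps it integral. *)
Lemma lead_binomial d (K : int) :
  lead d (fun t => (d`! * 'C(`|(t%:Z + K)%R|, d))%N%:Z) 1.
Proof.
pose p : {poly int} := \prod_(i <- index_iota 0 d) ('X - (i%:Z - K)%:P).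
have sp : size p = d.+1 by rewrite size_prod_XsubC size_iota subn0.
have <- : p`_d = 1.
  by have /monicP := monic_prod_XsubC (index_iota 0 d) predT (fun i : nat => i%:Z - K);
    rewrite lead_coefE -/p sp.
apply: (@lead_eventually _ _ _ _ (d + `|K|) _ (lead_poly _)); last by rewrite sp.
move=> t tK; rewrite fact_binomial_prod; last by lia.
rewrite horner_prod big_mkord.
by apply: eq_bigr => i _; rewrite !hornerE; lia.
Qed.

Lemma divz2K (a : int) : 2 * (a %/ 2)%Z + (odd `|a|)%:Z = a.
Proof. by case: (boolP (odd _)); lia. Qed.

Lemma divz2_bit (a : int) (b : bool) : ((2 * a + b%:Z) %/ 2)%Z = a.
Proof. by case: b; lia. Qed.

Section SimplexCoordinates.
Variables (n : nat) (w : 'I_n -> 'rV[int]_n) (u : 'rV[int]_n).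
Implicit Types (l : 'cV[int]_n * int) (t : int) (c z : 'rV[int]_n).

Let M : 'M[int]_n := \matrix_i (w i + u).

(** Coordinates on level t of Z^n x Z in which the t-th dilate of the simplex of the [w_i] becomes c
    >= 0, [csum c] = t. *)
Definition from_coords t c : 'rV[int]_n := c *m M - t *: u.

Definition to_coords t z : 'rV[int]_n := (z + t *: u) *m invmx M.

Lemma ev_mulmx l c :
  ev l (csum c) (c *m \matrix_i w i) = \sum_i c 0 i * ev l 1 (w i).
Proof.
rewrite mulmx_sum_row /csum ev_sum; apply: eq_bigr => i _.
by rewrite rowK -evZ mulr1.
Qed.

Lemma from_coordsE t c :
  from_coords t c = c *m (\matrix_i w i) + (csum c - t) *: u.
Proof.
rewrite /from_coords scalerBl addrA; congr (_ - _).
rewrite !mulmx_sum_row /csum scaler_suml -big_split; apply: eq_bigr => i _ /=.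
by rewrite !rowK scalerDr.
Qed.

(** In Z^n x Z the point is the sum of the c_i (w_i, 1) and (t - csum c) (-u, 1). *)
Lemma ev_from_coords l t c : ev l t (from_coords t c) =
  \sum_i c 0 i * ev l 1 (w i) + (t - csum c) * ev l 1 (- u).
Proof.
rewrite from_coordsE -{1}[t](subrK (csum c)) addrC evD; congr (_ + _).
  by rewrite -ev_mulmx.
by rewrite -evZ mulr1 -[csum c - t]opprB scaleNr scalerN.
Qed.

Hypothesis M_unit : M \in unitmx.

Lemma to_coordsK t z : from_coords t (to_coords t z) = z.
Proof. by rewrite /from_coords /to_coords mulmxKV// addrK. Qed.

Lemma from_coordsK t c : to_coords t (from_coords t c) = c.
Proof. by rewrite /from_coords /to_coords subrK mulmxK. Qed.

Lemma to_coords_vertex i : to_coords 1 (w i) = delta_mx 0 i.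
Proof.
rewrite /to_coords scale1r; have -> : w i + u = row i M by rewrite rowK.
by rewrite -row_mul mulmxV// row1.
Qed.

Lemma simplex_form_vertex e i : ev (simplex_form e M u) 1 (w i) = 0.
Proof.
rewrite ev_simplex_form -/(to_coords 1 (w i)) to_coords_vertex.
rewrite /csum (bigD1 i)//= big1 ?addr0 => [|k ki].
  by rewrite !mxE !eqxx subrr mulr0.
by rewrite !mxE (negPf ki).
Qed.

End SimplexCoordinates.

(** * Lattice counts under integral shifts of the facet inequalities *)

Section Polyhedron.
Variables (d : nat) (J : finType).
Local Notation n := d.+1.
Variables (f : J -> 'cV[int]_n * int) (w : J -> 'I_n -> 'rV[int]_n).
Variables (u : J -> 'rV[int]_n) (e : J -> int).

Let W j : 'M[int]_n := \matrix_i w j i.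
Let M j : 'M[int]_n := \matrix_i (w j i + u j).

Hypothesis e_unit : forall j, e j = 1 \/ e j = -1.
Hypothesis M_unit : forall j, M j \in unitmx.
Hypothesis f_def : forall j, f j = simplex_form (e j) (M j) (u j).
Hypothesis f_ge0 : forall j k i, 0 <= ev (f k) 1 (w j i).
Hypothesis f_neq : forall j k, j != k -> exists i, ev (f k) 1 (w j i) != 0.
(** [c *m W j] at level [csum c] always lies on the hyperplane of [j]; the condition says that the
    lattice points of the dilates on this hyperplane belong to the dilated simplex. *)
Hypothesis face_coords : forall j (c : 'rV[int]_n), 0 < csum c ->
  (forall k, 0 <= ev (f k) (csum c) (c *m W j)) -> forall i, 0 <= c 0 i.
Hypothesis interior_point :
  exists (r : nat) (z : 'rV[int]_n), (0 < r)%N /\ forall k, 1 <= ev (f k) r%:Z z.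

Definition region (k : J -> int) (t : int) : set 'rV[int]_n :=
  [set z | forall j, k j <= ev (f j) t z].

Hypothesis region0_finite : forall t : int, 0 < t -> finite_set (region (fun=> 0) t).

(** Adding K times an interior point raises every form by at least K, which embeds the region into
    an unshifted dilate of positive level. *)
Lemma region_finite k t : finite_set (region k t).
Proof.
have [r [c [r0 fc]]] := interior_point.
pose K : int := \sum_j `|k j| + `|t| + 1.
have kK j : `|k j| <= K.
  rewrite /K (bigD1 j)//= -!addrA lerDl !addr_ge0// sumr_ge0//.
have tK : `|t| + 1 <= K by rewrite /K -addrA lerDr sumr_ge0.
have fin : finite_set (region (fun=> 0) (t + K * r%:Z)).
  apply: region0_finite; have : K <= K * r%:Z by rewrite ler_peMr//; lia.
  by lia.
have sub : region k t `<=`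
    (fun z : 'rV[int]_n => z - K *: c) @` region (fun=> 0) (t + K * r%:Z).
  move=> z zk; exists (z + K *: c); last by rewrite addrK.
  move=> i; rewrite evD evZ; have := zk i; have := kK i.
  have : K <= K * ev (f i) r%:Z c by rewrite ler_peMr ?fc//; lia.
  by lia.
exact: sub_finite_set sub (finite_image _ fin).
Qed.

Let pt j := from_coords (w j) (u j).
Let co j := to_coords (w j) (u j).

Let ptK j t z : pt j t (co j t z) = z.
Proof. exact: to_coordsK (M_unit j) t z. Qed.

Let coK j t c : co j t (pt j t c) = c.
Proof. exact: from_coordsK (M_unit j) t c. Qed.

Let ev_self j t z : ev (f j) t z = e j * (t - csum (co j t z)).
Proof. by rewrite f_def ev_simplex_form. Qed.

Let ev_W l j c : ev (f l) (csum c) (c *m W j) = \sum_i c 0 i * ev (f l) 1 (w j i).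
Proof. exact: ev_mulmx. Qed.

Let ev_pt l j t c : ev (f l) t (pt j t c) =
  \sum_i c 0 i * ev (f l) 1 (w j i) + (t - csum c) * ev (f l) 1 (- u j).
Proof. exact: ev_from_coords. Qed.

Let ev_w j i : ev (f j) 1 (w j i) = 0.
Proof. by rewrite f_def (simplex_form_vertex (M_unit j)). Qed.

Let sum_w_gt0 l j : l != j -> 1 <= \sum_i ev (f l) 1 (w j i).
Proof.
rewrite eq_sym => /f_neq[i0 fi0]; rewrite (bigD1 i0)//=.
apply: (@le_trans _ _ (ev (f l) 1 (w j i0))).
  by rewrite -gtz0_ge1 lt_def fi0 f_ge0.
by rewrite lerDl; exact: sumr_ge0.
Qed.

Definition layer k j t : set 'rV[int]_n :=
  region k t `&` [set z | ev (f j) t z = k j].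

(* Up to a bounded shift, a lattice point of a layer near the facet [j] is a
   point of the [t]-th dilate of that unimodular facet. *)
Lemma lead_layer k j : lead d (fun t => (d`! * cnt (layer k j t%:Z))%N%:Z) 1.
Proof.
pose h l := ev (f l) 1 (- u j).
(* Adding K to all coordinates raises every other form by at least K, which outweighs its bound
   [k l] and the constant [e j * k j * h l] coming from the distance of the layer to the facet. *)
pose K : int := \sum_l (`|k l| + `|k j| * `|h l|).
have kK l : `|k l| + `|k j| * `|h l| <= K.
  by rewrite /K (bigD1 l)//= lerDl sumr_ge0// => i _; rewrite addr_ge0// mulr_ge0.
have K0 : 0 <= K by rewrite sumr_ge0// => i _; rewrite addr_ge0// mulr_ge0.
have ejE : e j * e j = 1 by case: (e_unit j) => ->; rewrite ?mulr1 ?mulrNN ?mulr1.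
have ekh l : `|e j * k j * h l| <= `|k j| * `|h l|.
  by rewrite !normrM; case: (e_unit j) => ->; rewrite ?normrN normr1 mul1r.
have layerP t c : (layer k j t) (pt j t c) <->
    csum c = t - e j * k j /\
    forall l, l != j -> k l <= \sum_i c 0 i * ev (f l) 1 (w j i) + e j * k j * h l.
  have selfE : (ev (f j) t (pt j t c) = k j) <-> csum c = t - e j * k j.
    rewrite ev_self coK; split=> [<-|->]; first by rewrite mulrA ejE mul1r; lia.
    by rewrite opprB addrC subrK mulrA ejE mul1r.
  split=> [[kc /selfE cs]|[/selfE cj kc]].
    by split=> // l lj; have := kc l; rewrite ev_pt cs opprB [t + _]addrC subrK.
  split=> //= l; have [->|lj] := eqVneq l j; first by rewrite cj.
  by rewrite ev_pt (iffLR selfE cj) opprB [t + _]addrC subrK kc.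
pose ones : 'rV[int]_n := K *: const_mx 1.
have csum_ones : csum ones = n%:Z * K.
  rewrite /csum; under eq_bigr do rewrite !mxE mulr1.
  by rewrite sumr_const card_ord -mulr_natl natz.
have sum_ones l c : \sum_i (c + ones) 0 i * ev (f l) 1 (w j i) =
    \sum_i c 0 i * ev (f l) 1 (w j i) + K * \sum_i ev (f l) 1 (w j i).
  by rewrite mulr_sumr -big_split; apply: eq_bigr => i _; rewrite !mxE mulr1 mulrDl.
have Ksum l : l != j -> K <= K * \sum_i ev (f l) 1 (w j i).
  by move=> lj; rewrite ler_peMr// sum_w_gt0.
(* The T-th dilate of the facet has C(d + T, d) lattice points. Here T is the coordinate sum t - e_j
   k_j of the layer, lowered or raised by n K, the sum of [ones]. *)
pose Kl : int := d%:Z - e j * k j - n%:Z * K.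
pose Ku : int := d%:Z - e j * k j + n%:Z * K.
apply: (lead_squeeze _ (lead_binomial d Kl) (lead_binomial d Ku)).
exists (`|(d%:Z - Kl)%R| + `|(d%:Z - Ku)%R| + 1)%N => t tT.
have tl : d%:Z <= t%:Z + Kl by lia.
have tu : d%:Z < t%:Z + Ku by lia.
rewrite !lez_nat !leq_mul2l; apply/andP; split; apply/orP; right.
  have -> : `|(t%:Z + Kl)%R|%N = (d + `|(t%:Z + Kl - d%:Z)%R|)%N by lia.
  have [fA <-] := cnt_dilated_face d `|(t%:Z + Kl - d%:Z)%R|%N.
  apply: (cnt_inj (g := fun c => pt j t%:Z (c + ones))) => //.
  - by apply: finite_setIl; exact: region_finite.
  - move=> c [c0 cT]; apply/layerP; split; first by rewrite csumD csum_ones cT /Kl; lia.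
    move=> l lj; rewrite sum_ones; have := Ksum l lj; have := kK l; have := ekh l.
    have : 0 <= \sum_i c 0 i * ev (f l) 1 (w j i).
      by apply: sumr_ge0 => i _; rewrite mulr_ge0.
    by lia.
  - by move=> x y _ _ /(congr1 (co j t%:Z)); rewrite !coK => /addIr.
have -> : `|(t%:Z + Ku)%R|%N = (d + `|(t%:Z + Ku - d%:Z)%R|)%N by lia.
have [fA <-] := cnt_dilated_face d `|(t%:Z + Ku - d%:Z)%R|%N.
apply: (cnt_inj (g := fun z => co j t%:Z z + ones)) => //.
- by apply: finite_setIl; exact: region_finite.
- move=> z; rewrite -[X in layer _ _ _ X](ptK j t%:Z); move: (co _ _ z) => c.
  move=> /layerP[cs ck]; have csE : csum (c + ones) = t%:Z + Ku - d%:Z.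
    by rewrite csumD csum_ones cs /Ku; lia.
  split; last by rewrite csE; lia.
  apply: (@face_coords j); first by rewrite csE; lia.
  move=> l; rewrite ev_W; have [->|lj] := eqVneq l j.
    by rewrite big1// => i _; rewrite ev_w mulr0.
  rewrite sum_ones; have := Ksum l lj; have := kK l; have := ekh l; have := ck l lj.
  move: (\sum_i _) (e j * k j * h l) (`|k j| * `|h l|) (K * _) => a b b' a'.
  by lia.
- by move=> x y _ _ /addIr/(congr1 (pt j t%:Z)); rewrite !ptK.
Qed.

Let raise (k : J -> int) j : J -> int := fun l => k l + (l == j)%:Z.

Let cnt_raise k j t :
  cnt (region k t) = (cnt (layer k j t) + cnt (region (raise k j) t))%N.
Proof.
rewrite (cnt_split (fun z => ev (f j) t z == k j) (region_finite k t)).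
congr addn; congr cnt; apply/seteqP; split=> z.
- by move=> [zk /eqP].
- by move=> [zk /= zj]; split=> //=; rewrite zj.
- move=> [zk /= zj] l; rewrite /raise; have := zk l.
  by case: eqVneq => [->|_]; move: zj; lia.
move=> zk; split.
  by move=> l; have := zk l; rewrite /raise; lia.
by have /= := zk j; rewrite /raise eqxx; lia.
Qed.

Let excess k t : int := d`!%:Z * ((cnt (region k t))%:Z - (cnt (region (fun=> 0) t))%:Z).

Lemma lead_region k : lead d (fun t => excess k t%:Z) (- \sum_j k j).
Proof.
(* Induction on the sum of the |k_j|: one k_j moves a unit towards 0, which adds or removes a single
   layer. *)
have [m] := ubnP (\sum_j `|k j|)%N; elim: m => // m IHm in k *; rewrite ltnS => km.
have step k' j : lead d (fun t => excess k' t%:Z - excess (raise k' j) t%:Z) 1.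
  apply: (@lead_eventually _ _ _ _ 0 _ (lead_layer k' j)) => t _.
  by rewrite /excess (cnt_raise k' j) PoszM PoszD; ring.
have sum_raise k' j : \sum_l raise k' j l = \sum_l k' l + 1.
  rewrite big_split /=; congr (_ + _).
  by rewrite (bigD1 j)//= eqxx big1 ?addr0// => l /negPf->.
have [k0|] := boolP [forall j, k j == 0].
  rewrite big1 ?oppr0; last by move=> j _; apply/eqP/(forallP k0).
  apply: (@lead_eventually _ _ _ _ 0 _ (lead0 d)) => t _.
  suff -> : k = fun=> 0 by rewrite /excess subrr mulr0.
  by apply/funext => j; apply/eqP/(forallP k0).
rewrite negb_forall => /existsP[j kj].
have sum_abs k' : (`|k' j| < `|k j|)%N -> (forall l, l != j -> k' l = k l) ->
    (\sum_l `|k' l| < m)%N.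
  move=> k'j k'l; apply: leq_trans km; rewrite (bigD1 j)//= [X in (_ < X)%N](bigD1 j)//=.
  by rewrite (eq_bigr (fun l => `|k l|%N)) ?ltn_add2r// => l /k'l ->.
have [kj0|kj0] := ltP 0 (k j).
  pose k' l := k l - (l == j)%:Z.
  have k'E : raise k' j = k by apply/funext => l; rewrite /raise /k' subrK.
  have /IHm IH : (\sum_l `|k' l| < m)%N.
    by apply: sum_abs => [|l /negPf lj]; rewrite /k' ?eqxx ?lj; lia.
  have -> : - \sum_l k l = - \sum_l k' l + - 1 by rewrite -[in LHS]k'E sum_raise opprD.
  apply: (@lead_eventually _ _ _ _ 0 _ (leadD IH (leadN (step k' j)))) => t _.
  by rewrite k'E; ring.
have /IHm IH : (\sum_l `|raise k j l| < m)%N.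
  by apply: sum_abs => [|l /negPf lj]; rewrite /raise ?eqxx ?lj; lia.
have -> : - \sum_l k l = - \sum_l raise k j l + 1 by rewrite sum_raise; ring.
apply: (@lead_eventually _ _ _ _ 0 _ (leadD IH (step k j))) => t _.
by ring.
Qed.

Let L t : int := (cnt (region (fun=> 0) t))%:Z.

(** Subtracting (q, 1) carries the region with shifts [ev (f j) 1 q] at level t onto the dilate of
    level t - 1. *)
Lemma lead_dilates_diff q :
  lead d (fun t => d`!%:Z * (L (t%:Z - 1) - L t%:Z)) (- \sum_j ev (f j) 1 q).
Proof.
apply: (@lead_eventually _ _ _ _ 0 _ (lead_region (fun j => ev (f j) 1 q))) => t _.
rewrite /excess /L; congr (_ * (_ - _)); congr Posz.
apply: (cnt_bij (g := fun z => z - q) (h := fun z => z + q)); try exact: region_finite.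
- by move=> z zq j; rewrite evB subr_ge0 zq.
- move=> z zq j; have -> : t%:Z = t%:Z - 1 + 1 by rewrite subrK.
  by rewrite evD lerDr; exact: zq.
- by move=> z _; rewrite subrK.
- by move=> z _; rewrite addrK.
Qed.

Let bits (b : {ffun 'I_n -> bool}) : 'rV[int]_n := \row_i (b i)%:Z.

(* [z + y / 2] lies in the [t]-th dilate iff [z] lies in this region.  As [y] and
   [- y] are congruent modulo 2, their regions have equally many points, and the
   two shifts of a form add up to 1 or 0 according to its parity at [y]. *)
Let half_shift (y : 'rV[int]_n) j : int := - (ev (f j) 0 y %/ 2)%Z.

Let half_shiftP y t z :
  region (half_shift y) t z <-> region (fun=> 0) (2 * t) (2 *: z + y).
Proof.
have E j : ev (f j) (2 * t) (2 *: z + y) = 2 * ev (f j) t z + ev (f j) 0 y.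
  by rewrite -evZ -evD addr0.
split=> zy j; have := zy j; rewrite E /half_shift; lia.
Qed.

Let cnt_half_shiftN y t :
  cnt (region (half_shift y) t) = cnt (region (half_shift (- y)) t).
Proof.
have E z : 2 *: (z + y) - y = 2 *: z + y.
  by rewrite scalerDr -addrA -[2 *: y]/((1 + 1) *: y) scalerDl scale1r addrK.
apply: (cnt_bij (g := fun z => z + y) (h := fun z => z - y)); try exact: region_finite.
- by move=> z /half_shiftP zy; apply/half_shiftP; rewrite E.
- by move=> z /half_shiftP zy; apply/half_shiftP; rewrite -E subrK.
- by move=> z _; rewrite addrK.
- by move=> z _; rewrite subrK.
Qed.

Let sum_half_shift y :
  2 * \sum_j half_shift y j = \sum_j (odd `|ev (f j) 0 y|)%:Z.
Proof.
(* The shifts for [y] and [- y] may differ form by form, but equal counts have equal leading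
   coefficients and hence equal sums of shifts. *)
have E : \sum_j half_shift y j = \sum_j half_shift (- y) j.
  apply: oppr_inj; apply: (lead_unique (lead_region (half_shift y))).
  apply: (@lead_eventually _ _ _ _ 0 _ (lead_region (half_shift (- y)))) => t _.
  by rewrite /excess -cnt_half_shiftN.
transitivity (\sum_j half_shift y j + \sum_j half_shift (- y) j).
  by rewrite -E; ring.
rewrite -big_split; apply: eq_bigr => j _ /=.
have : ev (f j) 0 (- y) = - ev (f j) 0 y by rewrite -evN oppr0.
by rewrite /half_shift => ->; lia.
Qed.

Let cnt_even_dilate t :
  L (2 * t) = \sum_b (cnt (region (half_shift (bits b)) t))%:Z.
Proof.
pose half (y : 'rV[int]_n) : 'rV[int]_n := map_mx (fun a => (a %/ 2)%Z) y.
pose par (y : 'rV[int]_n) : {ffun 'I_n -> bool} := [ffun i => odd `|y 0 i|].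
rewrite /L (cnt_partition par (region_finite _ _)).
rewrite (big_morph Posz PoszD (erefl _)); apply: eq_bigr => b _; congr Posz.
have E z : par (2 *: z + bits b) = b.
  by apply/ffunP => i; rewrite ffunE !mxE; case: (b i); lia.
have E2 y : par y = b -> 2 *: half y + bits b = y.
  by move=> <-; apply/rowP => i; rewrite !mxE ffunE divz2K.
apply: (cnt_bij (g := half) (h := fun z => 2 *: z + bits b)).
- by apply: finite_setIl; exact: region_finite.
- exact: region_finite.
- move=> y [yr /= yb]; apply/half_shiftP; move: yr.
  by rewrite -[y in region _ _ y](E2 y).
- by move=> z zb; split; [apply/half_shiftP|rewrite /= E].
- by move=> y [_ /= yb]; rewrite E2.
- by move=> z _; apply/rowP => i; rewrite /half !mxE divz2_bit.
Qed.

Let ev0_sum j y : ev (f j) 0 y = \sum_i y 0 i * ev (f j) 0 (delta_mx 0 i).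
Proof.
have -> : ev (f j) 0 y = ev (f j) (\sum_(i < n) 0) (\sum_i y 0 i *: delta_mx 0 i).
  by rewrite big1// -row_sum_delta.
by rewrite ev_sum; apply: eq_bigr => i _; rewrite -evZ mulr0.
Qed.

(* Some coordinate of a primitive normal is odd; flipping it changes the parity. *)
Let card_odd j : #|[set b | odd `|ev (f j) 0 (bits b)|]%SET| = (2 ^ d)%N.
Proof.
have [i0 odd_i0] : exists i0, odd `|ev (f j) 0 (delta_mx 0 i0)|.
  apply/existsP; apply: contraT => /existsPn even_f.
  pose z : 'rV[int]_n := row ord0 (M j).
  have : odd `|ev (f j) 0 z|.
    rewrite ev_self /co /to_coords scale0r addr0 -row_mul mulmxV//.
    have -> : csum (row ord0 (1%:M : 'M[int]_n)) = 1.
      rewrite /csum (bigD1 ord0)//= big1 ?addr0 => [|k k0]; first by rewrite !mxE.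
      by rewrite !mxE eq_sym (negPf k0).
    by case: (e_unit j) => ->.
  move=> odd_z; suff : ~~ odd `|ev (f j) 0 z| by rewrite odd_z.
  rewrite ev0_sum.
  elim/big_ind: _ => // [a b|i _]; first by lia.
  by have := even_f i; rewrite abszM oddM; case: odd; rewrite ?andbF.
pose flip (b : {ffun 'I_n -> bool}) : {ffun 'I_n -> bool} :=
  [ffun i => if i == i0 then ~~ b i else b i].
have flipK : involutive flip.
  by move=> b; apply/ffunP => i; rewrite !ffunE; case: eqP => // _; rewrite negbK.
have odd_flip b : odd `|ev (f j) 0 (bits (flip b))| = ~~ odd `|ev (f j) 0 (bits b)|.
  rewrite !ev0_sum (bigD1 i0)// [in RHS](bigD1 i0)//= !mxE ffunE eqxx.
  rewrite (eq_bigr (fun i => bits b 0 i * ev (f j) 0 (delta_mx 0 i))); last first.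
    by move=> i /negPf ii0; rewrite !mxE ffunE ii0.
  by move: odd_i0; case: (b i0) => /=; lia.
set A := [set b | _]%SET.
have : #|A| = #|~: A|.
  rewrite -(card_preimset _ (inv_inj flipK)); apply: eq_card => b.
  by rewrite !inE odd_flip.
have := cardsC A; rewrite card_ffun card_bool card_ord expnS; lia.
Qed.

(** The inner factor 2 clears the halves in [sum_half_shift]. After exchanging the sums, each form
    contributes its 2^d odd classes among the 2^n classes modulo 2. *)
Lemma lead_even_dilates : lead d
  (fun t => d`!%:Z * (2 * (L (2 * t%:Z) - 2 ^+ n * L t%:Z))) (- (#|J| * 2 ^ d)%:Z).
Proof.
have H := lead_sum (index_enum _) (fun b => leadZ 2 (lead_region (half_shift (bits b)))).
have -> : - (#|J| * 2 ^ d)%:Z = \sum_b 2 * - \sum_j half_shift (bits b) j.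
  under eq_bigr do rewrite mulrN sum_half_shift.
  rewrite sumrN exchange_big /=; congr (- _).
  under eq_bigr => j _.
    rewrite -(big_morph Posz PoszD (erefl _)).
    have -> : (\sum_(b : {ffun 'I_n -> bool}) odd `|ev (f j) 0 (bits b)| = 2 ^ d)%N.
      rewrite -(card_odd j) -sum1_card [RHS]big_mkcond; apply: eq_bigr => b _.
      by rewrite inE; case: odd.
    over.
  by rewrite sumr_const -mulr_natl natz PoszM.
apply: (@lead_eventually _ _ _ _ 0 _ H) => t _.
rewrite -mulr_sumr /excess -mulr_sumr sumrB -cnt_even_dilate sumr_const.
rewrite card_ffun card_bool card_ord /L -[X in _ - X]mulr_natl natrX; ring.
Qed.

End Polyhedron.

(** * Asymptotics of the Ehrhart polynomial of the small cross-polytope *)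

Section CrossEhrhartAsymptotics.
Variable d : nat.
Local Notation n := d.+1.

(** The polynomial with h^*-vector C(d,k), whose last entry C(d,n) is 0; [ehrhart_small_cross]
    identifies it. *)
Definition cross_ehrhart (t : nat) : int :=
  \sum_(k < n.+1) ('C(d, k))%:Z * ('C(t + n - k, n))%:Z.

Lemma lead_double u c : lead d u c -> lead d (fun t => u (2 * t)%N) (c * 2 ^+ d).
Proof.
move=> uc m; have [T H] := uc (m * 2 ^ d)%N; exists T => t Tt.
have {H} := H (2 * t)%N (leq_trans Tt (leq_pmull _ _)).
have pd : 0 < (2 ^+ d : int) by rewrite exprn_gt0.
have -> : (m * 2 ^ d)%N%:Z = 2 ^+ d * m%:Z.
  by rewrite PoszM mulrC; congr (_ * _); rewrite -natz natrX.
rewrite [(2 * t)%N%:Z]PoszM exprMn [c * (_ * _)]mulrA -!mulrA.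
by rewrite ler_pM2l//; apply.
Qed.

Lemma lead_cancel (a : nat) u c : (0 < a)%N ->
  lead d (fun t => a%:Z * u t) (a%:Z * c) -> lead d u c.
Proof.
move=> a0 uc m; have [T H] := uc m; exists T => t /H; apply: le_trans.
rewrite ler_wpM2l// -mulrA -mulrBr normrM ler_peMl//.
Qed.

Lemma sum_binomialz : \sum_(k < n) ('C(d, k))%:Z = 2 ^+ d.
Proof.
rewrite -[2]/(1 + 1) exprDn; apply: eq_bigr => k _.
by rewrite !expr1n mulr1 natz.
Qed.

(** The reflection of k to d - k negates each term. This symmetry of the h^*-vector fixes the second
    Ehrhart coefficient. *)
Lemma sum_binomial_antisym : \sum_(k < n) ('C(d, k))%:Z * (d%:Z - 2 * k%:Z) = 0.
Proof.
set S := \sum_(k < n) _; suff : S = - S by lia.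
rewrite /S -sumrN [LHS](reindex_inj rev_ord_inj); apply: eq_bigr => k _ /=.
have kd : (k <= d)%N by rewrite -ltnS.
rewrite subSS bin_sub// -subzn//; ring.
Qed.

(** By Pascal's rule the k-th binomial drops by C(t + d - k, d), so the coefficient is minus the sum
    of the h^*-vector. *)
Lemma lead_cross_diff :
  lead d (fun t => d`!%:Z * (cross_ehrhart t.-1 - cross_ehrhart t)) (- 2 ^+ d).
Proof.
have step (k : 'I_n.+1) : lead d (fun t => - ('C(d, k))%:Z *
    (d`! * 'C(`|(t%:Z + (d%:Z - k%:Z))%R|, d))%N%:Z) (- ('C(d, k))%:Z * 1).
  exact: leadZ (lead_binomial _ _).
have -> : - 2 ^+ d = \sum_(k < n.+1) - ('C(d, k))%:Z * 1.
  rewrite big_ord_recr /= bin_small// oppr0 mul0r addr0.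
  by under eq_bigr do rewrite mulr1; rewrite sumrN sum_binomialz.
apply: (lead_eventually (T := 1) _ (lead_sum _ step)) => -[//|t] _.
rewrite /cross_ehrhart -sumrB mulr_sumr; apply: eq_bigr => k _.
have kn : (k <= n)%N by rewrite -ltnS.
have -> : (t.+1 + n - k = (t + n - k).+1)%N by lia.
have -> : `|(t.+1%:Z + (d%:Z - k%:Z))%R|%N = (t + n - k)%N by lia.
by rewrite binS PoszD PoszM /=; ring.
Qed.

Lemma lead_cross_double : lead d
  (fun t => d`!%:Z * (2 * (cross_ehrhart (2 * t) - 2 ^+ n * cross_ehrhart t)))
  (- (2 ^ n * 2 ^ d)%:Z).
Proof.
pose a (k i : nat) : int := n%:Z - k%:Z - i%:Z.
pose lin (b : nat -> int) : {poly int} := \prod_(i <- index_iota 0 n) ('X - (b i)%:P).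
have sz b : size (lin b) = n.+1 by rewrite size_prod_XsubC size_iota subn0.
have topE b : (lin b)`_n = 1.
  have /monicP := monic_prod_XsubC (index_iota 0 n) predT b.
  by rewrite lead_coefE -/(lin b) sz.
have subE b : (lin b)`_d = - \sum_(i < n) b i.
  rewrite /lin -(big_map b predT (fun x => 'X - x%:P)).
  have := @coefPn_prod_XsubC _ (map b (index_iota 0 n)).
  rewrite size_map size_iota subn0 => -> //.
  by rewrite big_map big_mkord.
(* In the variable X = 2t both n! C(2t + n - k, n) and 2^n n! C(t + n - k, n) are monic of degree n,
   the power of 2 being absorbed by doubling the [a k i]. The difference has degree at most d, and
   its coefficient there is minus the sum of the [a k i]. *)
pose p k := lin (fun i => - a k i) - lin (fun i => - (2 * a k i)).
have sp k : (size (p k) <= n)%N.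
  apply/leq_sizeP => j; rewrite leq_eqVlt => /orP[/eqP<-|nj].
    by rewrite coefB !topE subrr.
  by rewrite coefB !nth_default ?subrr// sz.
have pd k : 2 * (p k)`_d = - (n%:Z * (n.+1%:Z - 2 * k%:Z)).
  have arith m (c : int) : 2 * \sum_(i < m) (c - i%:Z) = m%:Z * (2 * c - m%:Z + 1).
    elim: m => [|m IHm]; first by rewrite big_ord0 mulr0 mul0r.
    by rewrite big_ord_recr /= mulrDr IHm; lia.
  rewrite coefB !subE !sumrN -mulr_sumr !opprK.
  have -> : n.+1%:Z - 2 * k%:Z = 2 * (n%:Z - k%:Z) - n%:Z + 1 by lia.
  by rewrite -arith /a; ring.
have pE k t : (k <= n)%N -> (n <= t)%N -> (p k).[(2 * t)%N%:Z] =
    n`!%:Z * (('C(2 * t + n - k, n))%:Z - 2 ^+ n * ('C(t + n - k, n))%:Z).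
  move=> kn nt; rewrite mulrBr mulrCA -!PoszM !fact_binomial_prod; try lia.
  rewrite hornerD hornerN !horner_prod !big_mkord; congr (_ - _).
    by apply: eq_bigr => i _; rewrite !hornerE /a; lia.
  rewrite -[n in 2 ^+ n]card_ord -prodr_const -big_split; apply: eq_bigr => i _ /=.
  by rewrite !hornerE /a; lia.
(* The factor n turns d! into the n! that makes the binomials polynomials over the integers. *)
apply: (@lead_cancel n) => //.
have step (k : 'I_n.+1) :
    lead d (fun t => ('C(d, k))%:Z * (2 * (p k).[(2 * t)%N%:Z]))
           (('C(d, k))%:Z * (2 * ((p k)`_d * 2 ^+ d))).
  by do 2 apply: leadZ; apply: (lead_double (lead_poly (sp k))).
have -> : n%:Z * - (2 ^ n * 2 ^ d)%:Z =
    \sum_(k < n.+1) ('C(d, k))%:Z * (2 * ((p k)`_d * 2 ^+ d)).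
  rewrite big_ord_recr /= bin_small// mul0r addr0.
  (* n + 1 - 2k is split as (d - 2k) + 2: the first summand cancels by antisymmetry, the second
     gives 2 * 2^d = 2^n. *)
  transitivity (- (n%:Z * 2 ^+ d) *
      \sum_(k < n) ('C(d, k))%:Z * (d%:Z - 2 * k%:Z + 2)); last first.
    rewrite mulr_sumr; apply: eq_bigr => k _.
    by rewrite [2 * (_ * _)]mulrA pd; lia.
  under eq_bigr do rewrite mulrDr.
  rewrite big_split /= sum_binomial_antisym add0r -mulr_suml sum_binomialz.
  by rewrite PoszM -![(2 ^ _)%N%:Z]natz !natrX exprS; ring.
apply: (lead_eventually (T := n) _ (lead_sum _ step)) => t nt.
rewrite /cross_ehrhart !mulr_sumr -sumrB !mulr_sumr; apply: eq_bigr => k _.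
rewrite pE ?leq_ord// factS PoszM; ring.
Qed.

End CrossEhrhartAsymptotics.

(** * Rigidity from facet counts *)

Lemma sum_ge_eq (I : eqType) (r : seq I) (F G : I -> int) :
  (forall i, i \in r -> F i <= G i) -> \sum_(i <- r) G i <= \sum_(i <- r) F i ->
  forall i, i \in r -> F i = G i.
Proof.
move=> FG GF; have : \sum_(i <- r) (G i - F i) <= 0 by rewrite sumrB subr_le0.
elim: r FG {GF} => // j r IH FG; rewrite big_cons => GF.
have r0 : 0 <= \sum_(i <- r) (G i - F i).
  by rewrite big_seq sumr_ge0// => i ir; rewrite subr_ge0 FG// inE ir orbT.
have j0 := FG j (mem_head _ _); move=> i; rewrite inE => /orP[/eqP->|ir].
  by move: j0 r0 GF; set x := \sum_(i <- r) _; lia.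
apply: IH => //; first by move=> k kr; apply: FG; rewrite inE kr orbT.
by move: j0 r0 GF; set x := \sum_(i <- r) _; lia.
Qed.

Section Rigidity.
Variables (d : nat) (J : finType).
Local Notation n := d.+1.
Variables (f : J -> 'cV[int]_n * int) (w : J -> 'I_n -> 'rV[int]_n).
Variables (u : J -> 'rV[int]_n) (e : J -> int).

Let M j : 'M[int]_n := \matrix_i (w j i + u j).

Hypothesis e_unit : forall j, e j = 1 \/ e j = -1.
Hypothesis M_unit : forall j, M j \in unitmx.
Hypothesis f_def : forall j, f j = simplex_form (e j) (M j) (u j).
Hypothesis f_neq : forall j k, j != k -> exists i, ev (f k) 1 (w j i) != 0.

Variable Q : seq 'rV[int]_n.
Hypothesis Q_uniq : uniq Q.
Hypothesis Q_size : size Q = (2 * n)%N.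
Hypothesis Q_ge0 : forall j q, q \in Q -> 0 <= ev (f j) 1 q.
Hypothesis w_in_Q : forall j i, w j i \in Q.
Hypothesis zero_in_Q : forall j q, q \in Q -> ev (f j) 1 q = 0 -> exists i, q = w j i.
Hypothesis sum_Q : forall q, q \in Q -> \sum_j ev (f j) 1 q = 2 ^+ d.
Hypothesis card_J : #|J| = (2 ^ n)%N.

Let ev_w j i : ev (f j) 1 (w j i) = 0.
Proof. by rewrite f_def (simplex_form_vertex (M_unit j)). Qed.

Let w_inj j : injective (w j).
Proof.
move=> i k wik; have := to_coords_vertex (M_unit j) i.
rewrite wik (to_coords_vertex (M_unit j)) => /rowP/(_ i).
by rewrite !mxE !eqxx /=; have [->|] := eqVneq i k.
Qed.

Let zeros_perm j : perm_eq [seq q <- Q | ev (f j) 1 q == 0] (codom (w j)).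
Proof.
apply: uniq_perm; rewrite ?filter_uniq//.
  by rewrite map_inj_uniq ?enum_uniq//; exact: w_inj.
move=> q; rewrite mem_filter; apply/andP/codomP => [[/eqP q0 /zero_in_Q]|[i ->]].
  by apply.
by rewrite ev_w eqxx w_in_Q.
Qed.

Let zeros j : \sum_(q <- Q) (ev (f j) 1 q == 0)%:Z = n%:Z.
Proof.
rewrite -(big_morph Posz PoszD (erefl _)).
have -> : (\sum_(q <- Q) (ev (f j) 1 q == 0) = count (fun q => ev (f j) 1 q == 0) Q)%N.
  by rewrite -sum1_count [RHS]big_mkcond; apply: eq_bigr => q _; case: eqP.
rewrite -size_filter.
by rewrite (perm_size (zeros_perm j)) size_codom card_ord.
Qed.

(* Double counting: all the values add up to n 2^n, and each of the 2^n forms is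
   at least 1 at the n lattice points off its facet. *)
Let zero_one j q : q \in Q -> ev (f j) 1 q = (ev (f j) 1 q != 0)%:Z.
Proof.
move=> qQ; apply: esym.
have lower k q' : q' \in Q -> (ev (f k) 1 q' != 0)%:Z <= ev (f k) 1 q'.
  by move=> /(Q_ge0 k); case: eqVneq => //=; lia.
have nonzeros k : \sum_(q <- Q) (ev (f k) 1 q != 0)%:Z = n%:Z.
  have : \sum_(q <- Q) ((ev (f k) 1 q == 0)%:Z + (ev (f k) 1 q != 0)%:Z) = (2 * n)%N%:Z.
    rewrite -Q_size -sum1_size (big_morph Posz PoszD (erefl _)).
    by apply: eq_bigr => q' _; case: eqP.
  by rewrite big_split /= zeros; set x := \sum_(q <- Q) _; lia.
have sumJ k : \sum_(q <- Q) ev (f k) 1 q = n%:Z.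
  apply: esym; rewrite -(nonzeros k).
  apply: (sum_ge_eq (r := index_enum J)
    (F := fun k => \sum_(q <- Q) (ev (f k) 1 q != 0)%:Z)
    (G := fun k => \sum_(q <- Q) ev (f k) 1 q)) => [i _||].
  - by rewrite big_seq [X in _ <= X]big_seq; apply: ler_sum => q'; exact: lower.
  - under [X in _ <= X]eq_bigr do rewrite nonzeros.
    rewrite exchange_big (eq_big_seq _ sum_Q).
    rewrite big_const_seq iter_addr_0 count_predT Q_size sumr_const card_J.
    rewrite -[X in X <= _]mulr_natl -[X in _ <= X]mulr_natl natrM natrX exprS -[n%:Z]natz.
    by rewrite le_eqVlt; apply/orP; left; apply/eqP; ring.
  - exact: mem_index_enum.
apply: (sum_ge_eq (r := Q) (F := fun q => (ev (f j) 1 q != 0)%:Z)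
  (G := fun q => ev (f j) 1 q)) => //.
  by move=> q' /(lower j).
by rewrite nonzeros sumJ.
Qed.

Section Opposite.
Variable j0 : J.
Local Notation v := (w j0).

Let opp_seq := [seq q <- Q | ev (f j0) 1 q != 0].

Let opp (i : 'I_n) := nth 0 opp_seq i.

Let Q_perm : perm_eq Q (codom v ++ opp_seq).
Proof.
rewrite -(perm_filterC (fun q => ev (f j0) 1 q == 0) Q).
by rewrite perm_cat2r zeros_perm.
Qed.

Let opp_size : size opp_seq = n.
Proof.
have := perm_size Q_perm; rewrite size_cat size_codom card_ord Q_size mul2n -addnn.
by move=> /addnI.
Qed.

Let sum_over_Q (F : 'rV[int]_n -> int) :
  \sum_(q <- Q) F q = \sum_i F (v i) + \sum_(i < n) F (opp i).
Proof.
rewrite (perm_big _ Q_perm) big_cat big_map big_enum; congr (_ + _).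
by rewrite (big_nth 0) big_mkord opp_size.
Qed.

Let opp_Q (i : 'I_n) : opp i \in Q.
Proof.
have := mem_nth 0 (_ : (i < size opp_seq)%N); rewrite opp_size => /(_ (ltn_ord i)).
by rewrite mem_filter => /andP[].
Qed.

Let opp_height (i : 'I_n) : ev (f j0) 1 (opp i) = 1.
Proof.
have := mem_nth 0 (_ : (i < size opp_seq)%N); rewrite opp_size => /(_ (ltn_ord i)).
by rewrite mem_filter => /andP[g0 _]; rewrite zero_one// g0.
Qed.

Let v_or_opp q : q \in Q -> (exists i, q = v i) \/ (exists i : 'I_n, q = opp i).
Proof.
rewrite (perm_mem Q_perm) mem_cat => /orP[/codomP|qo]; first by left.
right; have iq : (index q opp_seq < n)%N.
  by move: qo; rewrite -index_mem; move=> /leq_trans; apply; rewrite opp_size.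
by exists (Ordinal iq); rewrite /opp nth_index.
Qed.

Let co := to_coords v (u j0).

(** The points off the facet [j0] have coordinate sum 1 - e, which leaves the coefficient e at
    [- u j0]; this is the constant term in [ev_opp]. *)
Let shift l := e j0 * ev (f l) 1 (- u j0).

Let csum_opp (i : 'I_n) : csum (co 1 (opp i)) = 1 - e j0.
Proof.
have := opp_height i; rewrite f_def ev_simplex_form.
rewrite -[csum (co _ _)]/(csum ((opp i + 1 *: u j0) *m invmx (M j0))).
by case: (e_unit j0) => ->; set c := csum _; lia.
Qed.

Let ev_opp l (i : 'I_n) :
  ev (f l) 1 (opp i) = \sum_k co 1 (opp i) 0 k * ev (f l) 1 (v k) + shift l.
Proof.
rewrite -{1}[opp i](to_coordsK (M_unit j0) 1) ev_from_coords.
by rewrite -/(co 1 (opp i)) csum_opp opprB addrCA subrr addr0.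
Qed.

Let profile l : {ffun 'I_n -> bool} := [ffun i => ev (f l) 1 (v i) != 0].

Let profile_ev l i : ev (f l) 1 (v i) = (profile l i)%:Z.
Proof. by rewrite ffunE; apply: zero_one. Qed.

Let profile_diff k l (i : 'I_n) : profile k = profile l ->
  ev (f k) 1 (opp i) - ev (f l) 1 (opp i) = shift k - shift l.
Proof.
move=> kl; rewrite !ev_opp; under eq_bigr do rewrite profile_ev kl -profile_ev.
by rewrite opprD addrACA subrr add0r.
Qed.

(** With equal profiles the two forms differ by a constant on the opposite points. If it is
    positive, [k] is 1 and [l] is 0 at all n of them; these use up the n zeros of [l], so neither
    form vanishes at any [v i], and [k] has no zeros left. *)
Let profile_shift k l : profile k = profile l -> shift k <= shift l.
Proof.
move=> kl; rewrite leNgt; apply/negP => lk.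
have gkl i : (ev (f k) 1 (opp i) != 0) /\ (ev (f l) 1 (opp i) == 0).
  move: lk; rewrite -subr_gt0 -(profile_diff i kl).
  by rewrite (zero_one k (opp_Q i)) (zero_one l (opp_Q i)); do 2 case: eqP.
have := zeros l; rewrite sum_over_Q.
under [X in _ + X]eq_bigr do rewrite (gkl _).2.
rewrite sumr_const card_ord natz => /(canRL (addrK _)); rewrite subrr => v0.
have vl i : ev (f l) 1 (v i) != 0.
  apply/negP => /eqP li; move/eqP: v0; rewrite (bigD1 i)//= li eqxx.
  have : 0 <= \sum_(i' < n | i' != i) (ev (f l) 1 (v i') == 0)%:Z by exact: sumr_ge0.
  by set x := \sum_(i' < n | _) _; lia.
have := zeros k; rewrite sum_over_Q big1; last first.
  by move=> i _; rewrite profile_ev kl -profile_ev (negPf (vl i)).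
by rewrite big1 ?addr0// => i _; rewrite (negPf (gkl i).1).
Qed.

Let profile_inj : injective profile.
Proof.
move=> k l kl; apply/eqP/negPn/negP => nkl.
have skl : shift k = shift l by apply/eqP; rewrite eq_le !profile_shift.
have [i /negP[]] := f_neq nkl; apply/eqP.
rewrite -[RHS](ev_w k i); have [[i' ->]|[i' ->]] := v_or_opp (w_in_Q k i).
  by rewrite !profile_ev kl.
by apply/eqP; rewrite eq_sym -subr_eq0 (profile_diff _ kl) skl subrr.
Qed.

(* The profiles of the 2^n facets are distinct, so every 0/1 vector is one. *)
Lemma opposite_vertices : exists w' : 'I_n -> 'rV[int]_n,
  [/\ forall q, (q \in Q) <-> exists i, q = v i \/ q = w' i,
      forall i, v i + w' i = v ord_max + w' ord_max
    & \matrix_i (if i == ord_max then w' i - v i else v i - v ord_max) \in unitmx].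
Proof.
have [p' _ profileK] : bijective profile.
  by apply: inj_card_bij profile_inj _; rewrite card_J card_ffun card_bool card_ord.
(* The facet that shares with [j0] all vertices except [v i]. The matrix [z] below records which
   opposite points lie on which of these facets and turns out to be a permutation matrix. *)
pose fac (i : 'I_n) := p' [ffun k => k == i].
have fac_v i k : ev (f (fac i)) 1 (v k) = (k == i)%:Z.
  by rewrite profile_ev profileK ffunE.
pose z i k : int := (ev (f (fac i)) 1 (opp k) == 0)%:Z.
have ev_z i k : ev (f (fac i)) 1 (opp k) = 1 - z i k.
  by rewrite (zero_one _ (opp_Q k)) /z; case: eqP.
have z_ge0 i k : 0 <= z i k by [].
have sum_delta (i : 'I_n) : \sum_k (k == i)%:Z = 1.
  by rewrite (bigD1 i)//= eqxx big1 ?addr0// => k /negPf->.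
(* Of the n lattice points on [fac i], n - 1 are among the [v k]. *)
have row_sum i : \sum_k z i k = 1.
  have := zeros (fac i); rewrite sum_over_Q.
  have -> : \sum_k (ev (f (fac i)) 1 (v k) == 0)%:Z = n%:Z - 1.
    apply/eqP; rewrite eq_sym subr_eq -{2}(sum_delta i) -big_split /=.
    rewrite (eq_bigr (fun=> 1)) => [|k _]; last by rewrite fac_v; case: (k == i).
    by rewrite sumr_const card_ord natz.
  by rewrite -/(z i _); set x := \sum_k _; rewrite -/x; lia.
(* Summed over i, the values at [opp k] give its coordinate sum 1 - e plus a constant, whatever k
   is; as all entries of [z] sum to n, each column sums to 1. *)
have [s col_sum_s] : exists s, forall k, \sum_i z i k = s.
  exists (n%:Z - (1 - e j0 + \sum_i shift (fac i))) => k.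
  have -> : \sum_i z i k = \sum_i (1 - ev (f (fac i)) 1 (opp k)).
    by apply: eq_bigr => i _; rewrite ev_z subKr.
  rewrite sumrB sumr_const card_ord natz; congr (_ - _).
  rewrite -(csum_opp k) -big_split; apply: eq_bigr => i _ /=.
  rewrite ev_opp (bigD1 i)//= fac_v eqxx mulr1 big1 ?addr0// => m /negPf mi.
  by rewrite fac_v mi mulr0.
have col_sum k : \sum_i z i k = 1.
  rewrite col_sum_s; have : \sum_k \sum_i z i k = n%:Z.
    rewrite exchange_big /=; under eq_bigr do rewrite row_sum.
    by rewrite sumr_const card_ord natz.
  under eq_bigr do rewrite col_sum_s.
  rewrite sumr_const card_ord -mulr_natl natz -[RHS]mulr1 => /mulfI; apply.
  by [].
have col_unique k i i' : z i k = 1 -> z i' k = 1 -> i = i'.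
  move=> zi zi'; apply/eqP/negPn/negP => ii'; have := col_sum k.
  rewrite (bigD1 i)//= zi (bigD1 i')//= 1?eq_sym// zi'.
  have : 0 <= \sum_(l < n | (l != i) && (l != i')) z l k by exact: sumr_ge0.
  by set x := \sum_(_ < _ | _) _; lia.
have /choice[sg sgP] : forall i, exists k, z i k = 1.
  move=> i; suff /existsP[k /eqP zk] : [exists k, z i k == 1] by exists k.
  apply: contraT => /existsPn zi.
  suff /eqP : \sum_k z i k = 0 by rewrite row_sum.
  by apply: big1 => k _; move: (zi k); rewrite /z; case: (_ == 0).
have sg_inj : injective sg.
  by move=> i k ik; apply: (col_unique (sg i)); rewrite ?sgP// ik sgP.
have fac_opp k i : ev (f (fac k)) 1 (opp (sg i)) = (k != i)%:Z.
  rewrite ev_z; have [->|ki] := eqVneq; first by rewrite sgP.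
  suff -> : z k (sg i) = 0 by [].
  have : z k (sg i) <> 1 by move=> /(col_unique _ _ _ (sgP i))/eqP;
    rewrite eq_sym (negPf ki).
  by rewrite /z; case: eqP.
have ev_diff l a b : ev l 0 (a - b) = ev l 1 a - ev l 1 b by rewrite -evB subrr.
exists (opp \o sg); split => [q|i|].
- split=> [/v_or_opp[[i ->]|[i ->]]|[i [->|->]]]; last exact: opp_Q.
  + by exists i; left.
  + by exists (invF sg_inj i); right; rewrite /= f_invF.
  + exact: w_in_Q.
(* The forms of [j0] and of all [fac i] determine a vector, and each of them takes the value 1 on
   every sum [v i + w' i]. *)
- have separation x : ev (f j0) 0 x = 0 -> (forall i, ev (f (fac i)) 0 x = 0) -> x = 0.
    rewrite -[x](to_coordsK (M_unit j0) 0); move: (to_coords _ _ _ _) => c x0 xi.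
    have c0 : csum c = 0.
      have : ev (f j0) 0 (from_coords v (u j0) 0 c) = e j0 * (0 - csum c).
        by rewrite f_def ev_simplex_form -[in RHS](from_coordsK (M_unit j0) 0 c).
      by rewrite x0; case: (e_unit j0) => ->; set y := csum _; lia.
    suff -> : c = 0 by rewrite /from_coords mul0mx scale0r subr0.
    apply/rowP => k; rewrite mxE -(xi k) ev_from_coords c0 subrr mul0r addr0.
    rewrite (bigD1 k)//= fac_v eqxx mulr1 big1 ?addr0// => m /negPf mk.
    by rewrite fac_v mk mulr0.
  have ev_sum4 l a b a' b' : ev l 0 (a + b - (a' + b')) =
      ev l 1 a + ev l 1 b - (ev l 1 a' + ev l 1 b').
    by rewrite -!evD -evB subrr.
  apply/eqP; rewrite -subr_eq0; apply/eqP/separation => [|k].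
    by rewrite ev_sum4 !ev_w !opp_height subrr.
  by rewrite ev_sum4 !fac_v !fac_opp ![k == _]eq_sym; do 2 case: (_ == k).
set A := \matrix_i _.
(* Paired with the forms of the [fac k], the last one replaced by that of [j0], the rows of [A] give
   a lower triangular matrix with unit diagonal. *)
pose l (k : 'I_n) := if k == ord_max then f j0 else f (fac k).
pose C : 'M[int]_n := \matrix_(i, k) - (l k).1 i 0.
have AC i k : (A *m C) i k = ev (l k) 0 (row i A).
  rewrite /ev mul0r sub0r mxE [X in - X]mxE -sumrN; apply: eq_bigr => m _.
  by rewrite [C m k]mxE [row i A 0 m]mxE mulrN.
have : \det (A *m C) = 1.
  rewrite det_trig; last first.
    apply/is_trig_mxP => i k ik; rewrite AC rowK.
    have -> : (i == ord_max) = false.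
      by apply/negbTE; rewrite neq_ltn (leq_trans ik) ?leq_ord.
    rewrite ev_diff /l; case: eqVneq => [_|kmax]; first by rewrite !ev_w subrr.
    have ik' : (i == k) = false by apply/negbTE; rewrite neq_ltn ik.
    by rewrite !fac_v ik' [_ == k]eq_sym (negPf kmax).
  apply: big1 => i _; rewrite AC rowK /l; case: eqVneq => [->|imax].
    by rewrite ev_diff opp_height ev_w.
  by rewrite ev_diff !fac_v eqxx eq_sym (negPf imax).
rewrite det_mulmx => AC1; rewrite unitmxE.
by apply/unitrPr; exists (\det C).
Qed.

End Opposite.

End Rigidity.

(** * Lattice points and facets of a toric diagram *)

Section Boundedness.
Variable n : nat.

Lemma finite_box (B : int) : finite_set [set z : 'rV[int]_n | forall i, `|z 0 i| <= B].
Proof.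
have [fin _] := cnt_dilated_simplex n `|(n%:Z * (2 * B))%R|.
pose b : 'rV[int]_n := B *: const_mx 1.
apply: sub_finite_set (finite_image (fun z : 'rV[int]_n => z - b) fin) => z zB.
exists (z + b); last by rewrite addrK.
have bE i : (z + b) 0 i = z 0 i + B by rewrite !mxE mulr1.
have zb i : 0 <= z 0 i + B <= 2 * B by move: (zB i) => /=; move: (z 0 i) => a; lia.
split=> [i|]; first by rewrite bE; case/andP: (zb i).
apply: (@le_trans _ _ (\sum_(i < n) 2 * B)).
  by apply: ler_sum => i _; rewrite bE; case/andP: (zb i).
by rewrite sumr_const card_ord -mulr_natl natz; lia.
Qed.

Variable R : realType.

Definition dilate_points (D : set 'rV[R]_n) (t : int) : set 'rV[int]_n :=
  [set z | exists2 x, D x & lat R z = t%:~R *: x].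

Lemma ehrhart_cnt D t : ehrhart D t = cnt (dilate_points D t%:Z).
Proof. by []. Qed.

Lemma dilate_points_finite (s : seq 'rV[int]_n) t :
  finite_set (dilate_points (conv [seq lat R z | z <- s]) t).
Proof.
pose B : int := \sum_(v <- s) \sum_i `|v 0 i|.
apply: sub_finite_set (finite_box (`|t| * B)) => z [x sx zx] i.
have bound (e : int) : e = 1 \/ e = -1 -> e%:~R * x 0 i <= B%:~R.
  move=> e1; pose l : 'cV[R]_(n + 1) := col_mx (- e%:~R *: delta_mx i 0) (B%:~R)%:M.
  have lE y : aff l y = B%:~R - e%:~R * y 0 i.
    rewrite affE addrC; congr (_ + _); rewrite /dot (bigD1 i)//= big1 ?addr0.
      by rewrite !mxE !eqxx mulr1 mulNr.
    by move=> k /negPf ki; rewrite !mxE ki mulr0 mul0r.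
  rewrite -subr_ge0 -lE; apply: conv_aff_ge0 sx => _ /mapP[v vs ->].
  rewrite lE mxE -intrM -intrB ler0z subr_ge0.
  apply: (@le_trans _ _ (\sum_k `|v 0 k|)).
    rewrite (bigD1 i)//= ler_wpDr ?sumr_ge0//.
    by case: e1 => ->; rewrite ?mul1r ?mulN1r ?ler_norm// lerNl; lia.
  by rewrite /B (big_rem v)//= lerDl !sumr_ge0// => *; exact: sumr_ge0.
have xB : `|x 0 i| <= B%:~R.
  by rewrite ler_norml lerNl -mulN1r -[x 0 i in X in _ && X]mul1r (bound (-1)) ?(bound 1);
    [|left|right].
have /rowP/(_ i) := zx; rewrite !mxE => ziE.
by rewrite /= -(ler_int R) intr_norm ziE normrM intrM intr_norm ler_wpM2l.
Qed.

End Boundedness.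

Section FacetData.
Variables (R : realType) (d : nat).
Local Notation n := d.+1.
Implicit Types (D : set 'rV[R]_n).

Record datum := Datum {
  dvert : n.-tuple 'rV[int]_n; dshift : 'rV[int]_n; dsign : int }.

Definition datum_mx (p : datum) : 'M[int]_n :=
  \matrix_i (tnth (dvert p) i + dshift p).

Definition datum_form p := simplex_form (dsign p) (datum_mx p) (dshift p).

Definition facet_datum D (p : datum) : Prop :=
  [/\ dsign p = 1 \/ dsign p = -1, datum_mx p \in unitmx,
      forall x, D x -> 0 <= aff (real_form R (datum_form p)) x,
      forall x, D x -> aff (real_form R (datum_form p)) x = 0 ->
        conv [seq lat R z | z <- dvert p] x
    & forall i, D (lat R (tnth (dvert p) i))].

Lemma facet_datum_separation (s : seq 'rV[R]_n) x :
  toric_diagram (conv s) -> ~ conv s x ->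
  exists2 p, facet_datum (conv s) p & aff (real_form R (datum_form p)) x < 0.
Proof.
move=> [_ dimD _ uniD] nDx; have [l [Dl lx Fl]] := facet_separation dimD nDx.
have [w [u [Fw uM]]] := uniD _ Fl.
have [e [k [e1 k0] lk]] := facet_form dimD Dl Fl.2 Fw uM.
exists (Datum w u e); last by rewrite -(pmulr_rlt0 _ k0) -lk.
split=> //.
- by move=> y Dy; rewrite -(pmulr_rge0 _ k0) -lk Dl.
- by move=> y Dy y0; rewrite -Fw; split=> //=; rewrite lk y0 mulr0.
- move=> i; suff [] : (conv s `&` [set y | aff l y = 0]) (lat R (tnth w i)) by [].
  by rewrite Fw; apply/conv_mem/map_f/mem_tnth.
Qed.

Lemma ev_datum_shift p : ev (datum_form p) 1 (- dshift p) = dsign p.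
Proof.
rewrite ev_simplex_form scale1r addNr mul0mx /csum big1 ?subr0 ?mulr1// => i _.
by rewrite mxE.
Qed.

(** By [ev_from_coords] a form vanishing at the vertices is determined by its value at [- dshift p],
    where the form of [p] is 1 or -1. *)
Lemma ev_proportional p l :
  dsign p = 1 \/ dsign p = -1 -> datum_mx p \in unitmx ->
  (forall i, ev l 1 (tnth (dvert p) i) = 0) ->
  exists k : int, forall t z, ev l t z = k * ev (datum_form p) t z.
Proof.
move=> e1 uM l0; exists (ev l 1 (- dshift p) * dsign p) => t z.
rewrite -{1}[z](to_coordsK uM t) ev_from_coords big1 ?add0r => [|i _]; last first.
  by rewrite l0 mulr0.
rewrite ev_simplex_form -[X in csum X]/(to_coords (tnth (dvert p)) (dshift p) t z).
by case: e1 => ->; ring.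
Qed.

Lemma aff_proportional (l l' : 'cV[int]_n * int) (k : int) :
  (forall t z, ev l t z = k * ev l' t z) ->
  forall x, aff (real_form R l) x = k%:~R * aff (real_form R l') x.
Proof.
move=> ll' x; have l2 : l.2 = k * l'.2.
  by have := ll' 1 0; rewrite /ev !mul0mx !mxE !subr0 !mul1r.
have l1 i : l.1 i 0 = k * l'.1 i 0.
  have := ll' 0 (delta_mx 0 i); rewrite /ev !mul0r !sub0r -!rowE !mxE mulrN.
  by move/oppr_inj.
rewrite !aff_real_form l2 intrM mulrBr; congr (_ - _).
rewrite !mxE mulr_sumr; apply: eq_bigr => i _.
by rewrite !mxE l1 intrM mulrCA.
Qed.

Variables (s : seq 'rV[int]_n).
Let D := conv [seq lat R z | z <- s].
Hypothesis toricD : toric_diagram D.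

Let Q : seq 'rV[int]_n := fset_set (dilate_points D 1).

Let QP q : (q \in Q) <-> D (lat R q).
Proof.
rewrite /Q in_fset_set; last exact: dilate_points_finite.
rewrite inE; split=> [[x Dx ->]|Dq]; first by rewrite scale1r.
by exists (lat R q); rewrite ?scale1r.
Qed.

(* Encoding a facet by the set of its lattice points makes the facets a finType. *)
Definition facet_code (A : {set 'I_(size Q)}) : bool :=
  `[< exists2 p, facet_datum D p &
      forall i, (i \in A) = (ev (datum_form p) 1 Q`_i == 0) >].

Definition facet_index : finType := {A | facet_code A}.

Let dat (j : facet_index) : datum :=
  projT1 (cid2 (asboolW (valP j))).

Let datP j : facet_datum D (dat j).
Proof. by rewrite /dat; case: cid2. Qed.

Let dat_code (j : facet_index) i : (i \in val j) = (ev (datum_form (dat j)) 1 Q`_i == 0).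
Proof. by rewrite /dat; case: cid2. Qed.

Let f j := datum_form (dat j).
Let w j := tnth (dvert (dat j)).
Let u j := dshift (dat j).
Let e j := dsign (dat j).

Let e_unit j : e j = 1 \/ e j = -1. Proof. by case: (datP j). Qed.

Let M_unit j : \matrix_i (w j i + u j) \in unitmx. Proof. by case: (datP j). Qed.

Let f_def j : f j = simplex_form (e j) (\matrix_i (w j i + u j)) (u j).
Proof. by []. Qed.

Let f_ge0D j z : D (lat R z) -> 0 <= ev (f j) 1 z.
Proof. by have [_ _ fD _ _] := datP j; move/fD; rewrite aff_real_form_lat ler0z. Qed.

Let w_D j i : D (lat R (w j i)). Proof. by have [_ _ _ _] := datP j; apply. Qed.

(** A form of [k] that vanishes on the facet [j] is a nonzero multiple of that of [j], and then both
    facets have the same code. *)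
Let f_neq j k : j != k -> exists i, ev (f k) 1 (w j i) != 0.
Proof.
move=> jk; suff /existsP : [exists i, ev (f k) 1 (w j i) != 0] by [].
apply: contraNT jk; rewrite negb_exists => /forallP fk0.
have [k' k'E] : exists k' : int, forall t z, ev (f k) t z = k' * ev (f j) t z.
  apply: ev_proportional (e_unit j) (M_unit j) _ => i.
  by have := fk0 i; rewrite negbK => /eqP.
have k'0 : k' != 0.
  apply/eqP => k'0; have := ev_datum_shift (dat k); rewrite k'E k'0 mul0r.
  by case: (e_unit k); rewrite /e => ->.
apply/eqP/val_inj/setP => i; rewrite !dat_code -/(f j) -/(f k) k'E.
by rewrite mulf_eq0 (negPf k'0).
Qed.

Let s_D v : v \in s -> D (lat R v).
Proof. by move=> vs; apply/conv_mem/map_f. Qed.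

Let datum_nonzero p : facet_datum D p -> exists2 v, v \in s & ev (datum_form p) 1 v != 0.
Proof.
move=> [e1 _ _ _ _]; have [_ dimD _ _] := toricD.
have [|_ /mapP[v vs ->]] := dim_spans dimD (l := real_form R (datum_form p)).
  apply/eqP => p0; have := aff_real_form_lat R (datum_form p) (- dshift p).
  rewrite p0 /aff mulmx0 mxE ev_datum_shift => /esym/eqP; rewrite intr_eq0.
  by case: e1 => ->.
by rewrite aff_real_form_lat intr_eq0; exists v.
Qed.

(** The datum chosen for the code of [p] may differ from [p]. Its form vanishes at the vertices of
    [p], hence is a multiple of the form of [p], and a generator of [D] off the facet shows that the
    factor is positive. *)
Let separation x : ~ D x -> exists j, aff (real_form R (f j)) x < 0.
Proof.
move=> /(facet_datum_separation toricD)[p Dp px].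
pose A := [set i : 'I_(size Q) | ev (datum_form p) 1 Q`_i == 0]%SET.
have cA : facet_code A by apply/asboolP; exists p => // i; rewrite inE.
pose j : facet_index := exist _ A cA; exists j.
have [e1 uM pD _ pw] := Dp.
have fj0 q : D (lat R q) -> (ev (f j) 1 q == 0) = (ev (datum_form p) 1 q == 0).
  move=> /QP qQ; have qi : (index q Q < size Q)%N by rewrite index_mem.
  have qE : Q`_(Ordinal qi) = q by apply: nth_index.
  have jA : val j = A by [].
  have := dat_code j (Ordinal qi); rewrite qE jA => <-.
  by rewrite inE qE.
have pv i : ev (datum_form p) 1 (tnth (dvert p) i) = 0.
  by apply: simplex_form_vertex.
have [k kE] : exists k : int, forall t z, ev (f j) t z = k * ev (datum_form p) t z.
  by apply: ev_proportional e1 uM _ => i; apply/eqP; rewrite (fj0 _ (pw i)) pv.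
rewrite (aff_proportional kE) pmulr_rlt0// ltr0z.
have [v vs pv0] := datum_nonzero Dp.
have := f_ge0D j (s_D vs); have := fj0 v (s_D vs); rewrite kE mulf_eq0 (negPf pv0) orbF.
have : 0 < ev (datum_form p) 1 v.
  by rewrite lt_def pv0 -(ler0z R) -aff_real_form_lat pD//; exact: s_D.
by move=> p0 k0; rewrite pmulr_lge0// lt_def k0.
Qed.
Let regionE (t : int) : 0 < t -> region f (fun=> 0) t = dilate_points D t.
Proof.
move=> t0; have tR : 0 < t%:~R :> R by rewrite ltr0z.
apply/seteqP; split=> z.
  move=> zf; pose x := t%:~R^-1 *: lat R z.
  have zx : lat R z = t%:~R *: x by rewrite /x scalerA divff ?scale1r// gt_eqF.
  exists x => //; apply: contrapT => /separation[j]; rewrite ltNge => /negP; apply.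
  by rewrite -(pmulr_rge0 _ tR) -(aff_real_form_ev _ zx) ler0z; exact: zf.
move=> [x Dx zx] j; rewrite -(ler0z R) (aff_real_form_ev _ zx) mulr_ge0 ?(ltW tR)//.
by have [_ _ fD _ _] := datP j; exact: fD.
Qed.

Let region0_finite (t : int) : 0 < t -> finite_set (region f (fun=> 0) t).
Proof. by move=> /regionE->; exact: dilate_points_finite. Qed.

Let f_ge0 j k i : 0 <= ev (f k) 1 (w j i). Proof. by apply: f_ge0D; exact: w_D. Qed.

(** The sum of the generators: each form is nonnegative at all of them and positive at one. *)
Let interior_point :
  exists (r : nat) (z : 'rV[int]_n), (0 < r)%N /\ forall k, 1 <= ev (f k) r%:Z z.
Proof.
exists (size s), (\sum_(v <- s) v); split.
  have [_ [[P [_ DP]] _] _ _] := toricD.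
  have [c [_ c1 _]] := DP ord0; rewrite lt0n; apply/eqP => s0.
  suff : 1 = 0 :> R by move/eqP; rewrite oner_eq0.
  have sz0 : size [seq lat R z | z <- s] = 0%N by rewrite size_map s0.
  rewrite -c1; apply: big1 => i _; exfalso.
  by case: i => i isz; move: (isz); rewrite sz0.
move=> k; have -> : (size s)%:Z = \sum_(v <- s) 1.
  by rewrite -sum1_size (big_morph Posz PoszD (erefl _)).
rewrite ev_sum; have [v vs v0] := datum_nonzero (datP k).
rewrite (big_rem v)//=; apply: (@le_trans _ _ (ev (f k) 1 v)).
  by rewrite -gtz0_ge1 lt_def v0 f_ge0D//; exact: s_D.
by rewrite lerDl big_seq sumr_ge0// => q /mem_rem qs; apply/f_ge0D/s_D.
Qed.

Let face_coords j (c : 'rV[int]_n) : 0 < csum c ->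
  (forall k, 0 <= ev (f k) (csum c) (c *m \matrix_i w j i)) -> forall i, 0 <= c 0 i.
Proof.
move=> c0 ck; have : region f (fun=> 0) (csum c) (c *m \matrix_i w j i) by [].
rewrite regionE// => -[x Dx cx].
have [_ uM _ fw _] := datP j.
apply: (simplex_coords (erefl _) uM c0 cx); apply: fw => //.
have /esym/eqP := aff_real_form_ev (f j) cx; rewrite ev_mulmx big1 => [|i _].
  by rewrite mulf_eq0 intr_eq0 gt_eqF//= => /eqP.
by rewrite f_def simplex_form_vertex ?mulr0.
Qed.

Hypothesis ehrhartD : forall t : nat, (0 < t)%N -> (ehrhart D t)%:Z = cross_ehrhart d t.

Let cnt_region (t : nat) : (0 < t)%N ->
  (cnt (region f (fun=> 0) t%:Z))%:Z = cross_ehrhart d t.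
Proof. by move=> t0; rewrite regionE// -ehrhart_cnt ehrhartD. Qed.

Let sum_forms q : \sum_j ev (f j) 1 q = 2 ^+ d.
Proof.
apply: oppr_inj; apply: (lead_unique _ (lead_cross_diff d)).
(* From t = 2 on, as the Ehrhart function is prescribed at t - 1 only when this is positive. *)
apply: (lead_eventually (T := 2) _ (lead_dilates_diff e_unit M_unit f_def f_ge0 f_neq
  face_coords interior_point region0_finite q)) => -[//|t] t2.
have -> : t.+1%:Z - 1 = t%:Z by lia.
by rewrite (cnt_region (ltn0Sn t)) (cnt_region (t2 : (0 < t)%N)).
Qed.

Let card_index : #|facet_index| = (2 ^ n)%N.
Proof.
have even_lead := lead_even_dilates e_unit M_unit f_def f_ge0 f_neq
  face_coords interior_point region0_finite.
have : - (#|facet_index| * 2 ^ d)%:Z = - (2 ^ n * 2 ^ d)%:Z.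
  apply: (lead_unique _ (lead_cross_double d)).
  apply: (lead_eventually (T := 1) _ even_lead) => t t1.
  have t2 : (0 < 2 * t)%N by rewrite muln_gt0.
  by rewrite -(cnt_region t1) -(cnt_region t2).
by move/oppr_inj => -[/eqP]; rewrite eqn_pmul2r ?expn_gt0// => /eqP.
Qed.

Let Q_size : size Q = (2 * n)%N.
Proof.
have : (size Q)%:Z = cross_ehrhart d 1 by rewrite -ehrhartD.
(* At t = 1 only k = 0 and k = 1 contribute, namely (n + 1) + d = 2n. *)
rewrite /cross_ehrhart 2!big_ord_recl big1 => [|k _]; last first.
  by rewrite [X in _ * X](_ : _ = 0) ?mulr0// bin_small//= /bump /=; lia.
rewrite /= /bump /= bin0 bin1 !add1n subn0 subn1 binSn binn.
by lia.
Qed.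

Let unit_row (c : 'rV[int]_n) : csum c = 1 -> (forall i, 0 <= c 0 i) ->
  exists i, c = delta_mx 0 i.
Proof.
move=> c1 c0; suff /existsP[i ci] : [exists i, 0 < c 0 i].
  exists i; have rest : \sum_(k < n | k != i) c 0 k <= 0.
    move: c1; rewrite /csum (bigD1 i)//= => c1.
    by rewrite -(lerD2l (c 0 i)) c1 addr0 -gtz0_ge1.
  have ck k : k != i -> c 0 k = 0.
    move=> ki; apply/eqP; rewrite eq_le c0 andbT; apply: le_trans rest.
    by rewrite (bigD1 k)//= lerDl sumr_ge0.
  apply/rowP => k; rewrite mxE eqxx /=; have [->|/ck//] := eqVneq k i.
  by move: c1; rewrite /csum (bigD1 i)//= big1 ?addr0// => k' /ck.
apply: contraT => /existsPn ci; have : csum c <= 0.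
  by apply: sumr_le0 => i _; rewrite leNgt ci.
by rewrite c1.
Qed.

(** In the coordinates of the facet, [q] is a vector of nonnegative integers with sum 1. *)
Let zero_in_Q j q : q \in Q -> ev (f j) 1 q = 0 -> exists i, q = w j i.
Proof.
move=> /QP qD q0; pose c := to_coords (w j) (u j) 1 q.
have c1 : csum c = 1.
  move: q0; rewrite f_def ev_simplex_form -[X in csum X]/c.
  by case: (e_unit j) => ->; move: (csum c) => k; lia.
have qE : q = c *m \matrix_i w j i.
  by rewrite -(to_coordsK (M_unit j) 1 q) from_coordsE -/c c1 subrr scale0r addr0.
have [|i ci] := unit_row c1.
  by apply: (@face_coords j); rewrite c1// => k; rewrite -qE f_ge0D.
by exists i; rewrite qE ci -rowE rowK.
Qed.

Lemma toric_cross_structure : exists (v v' : 'I_n -> 'rV[int]_n),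
  [/\ forall q, D (lat R q) <-> exists i, q = v i \/ q = v' i,
      forall i, v i + v' i = v ord_max + v' ord_max
    & \matrix_i (if i == ord_max then v' i - v i else v i - v ord_max) \in unitmx].
Proof.
have [j0 _] : exists j0 : facet_index, True.
  have : (0 < #|facet_index|)%N by rewrite card_index expn_gt0.
  by case/card_gt0P => j; exists j.
have Q_ge0 j q : q \in Q -> 0 <= ev (f j) 1 q by move=> /QP; exact: f_ge0D.
have w_in_Q j i : w j i \in Q by apply/QP; exact: w_D.
have [v' [Qv vv' Av]] := opposite_vertices e_unit M_unit f_def f_neq (fset_uniq _)
  Q_size Q_ge0 w_in_Q zero_in_Q (fun q _ => sum_forms q) card_index j0.
exists (w j0), v'; split=> // q; split=> [/QP/Qv//|/Qv/QP//].
Qed.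

End FacetData.

(** * The small cross-polytope *)

Lemma conv_mapP (T : Type) (x0 : T) (R : realType) n (g : T -> 'rV[R]_n) (s : seq T) y :
  conv [seq g x | x <- s] y <-> exists c : 'I_(size s) -> R,
    [/\ forall i, 0 <= c i, \sum_i c i = 1 & y = \sum_i c i *: g (nth x0 s i)].
Proof.
have sz := size_map g s.
split=> [[c [c0 c1 ->]]|[c [c0 c1 ->]]].
  exists (c \o cast_ord (esym sz)); split.
  - by move=> i; exact: c0.
  - rewrite -c1 [RHS](reindex (cast_ord (esym sz)))//=.
    by exists (cast_ord sz) => i _; rewrite ?cast_ordK ?cast_ordKV.
  - rewrite (reindex (cast_ord (esym sz)))/=; last first.
      by exists (cast_ord sz) => i _; rewrite ?cast_ordK ?cast_ordKV.
    by apply: eq_bigr => i _; rewrite /= (nth_map x0).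
exists (c \o cast_ord sz); split.
- by move=> i; exact: c0.
- rewrite -c1 [RHS](reindex (cast_ord sz))//=.
  by exists (cast_ord (esym sz)) => i _; rewrite ?cast_ordK ?cast_ordKV.
- rewrite (reindex (cast_ord sz))/=; last first.
    by exists (cast_ord (esym sz)) => i _; rewrite ?cast_ordK ?cast_ordKV.
  by apply: eq_bigr => i _; rewrite /= (nth_map x0)// -(size_map g).
Qed.

Lemma conv_affine (R : realType) n (A : 'M[int]_n) (u : 'rV[int]_n) (s : seq 'rV[int]_n) :
  conv [seq lat R (z *m A + u) | z <- s] =
  [set x *m map_mx intr A + lat R u | x in conv [seq lat R z | z <- s]].
Proof.
have E (c : 'I_(size s) -> R) : \sum_i c i = 1 ->
    \sum_i c i *: lat R (nth 0 s i *m A + u) =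
    (\sum_i c i *: lat R (nth 0 s i)) *m map_mx intr A + lat R u.
  move=> c1; rewrite -[lat R u in RHS]scale1r -[X in X *: lat R u]c1.
  rewrite scaler_suml mulmx_suml -big_split.
  by apply: eq_bigr => i _; rewrite /lat map_mxD map_mxM scalerDr scalemxAl.
apply/seteqP; split=> [y /(conv_mapP 0)[c [c0 c1 ->]]|
    _ [x /(conv_mapP 0)[c [c0 c1 ->]] <-]].
  exists (\sum_i c i *: lat R (nth 0 s i)); last by rewrite E.
  by apply/(conv_mapP 0); exists c.
by apply/(conv_mapP 0); exists c; rewrite E.
Qed.

Lemma conv_eq (R : realType) n (s s' : seq 'rV[R]_n) : s =i s' -> conv s = conv s'.
Proof.
by move=> ss'; apply/seteqP; split; apply: conv_sub => v vs; apply: conv_mem;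
  rewrite ?ss' // -ss'.
Qed.

Section SmallCross.
Variable d : nat.
Local Notation n := d.+1.

Lemma basis_vec_mul (A : 'M[int]_n) (i : 'I_n) : basis_vec n i *m A = row i A.
Proof.
rewrite rowE; congr (_ *m _); by apply/rowP => j; rewrite !mxE eqxx.
Qed.

Lemma small_cross_verticesP (z : 'rV[int]_n) : z \in small_cross_vertices n <->
  [\/ z = 0, z = basis_vec n d, exists2 i, (i < d)%N & z = basis_vec n i
    | exists2 i, (i < d)%N & z = basis_vec n d - basis_vec n i].
Proof.
rewrite /small_cross_vertices !mem_cat !inE /=; split.
  case/or3P=> [/orP[/eqP|/eqP]|/mapP[i]|/mapP[i]].
  - by constructor 1.
  - by constructor 2.
  - by rewrite mem_iota => /= id ->; constructor 3; exists i.
  - by rewrite mem_iota => /= id ->; constructor 4; exists i.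
case=> [->|->|[i id ->]|[i id ->]]; rewrite ?eqxx ?orbT//; apply/orP; right; apply/orP.
  by left; apply: map_f; rewrite mem_iota.
by right; apply/mapP; exists i; rewrite // mem_iota.
Qed.

Lemma cross_structure_equiv (R : realType) (D : set 'rV[R]_n)
    (v v' : 'I_n -> 'rV[int]_n) :
  lattice_polytope D ->
  (forall q, D (lat R q) <-> exists i, q = v i \/ q = v' i) ->
  (forall i, v i + v' i = v ord_max + v' ord_max) ->
  \matrix_i (if i == ord_max then v' i - v i else v i - v ord_max) \in unitmx ->
  unimod_equiv (small_cross R n) D.
Proof.
move=> [s DE] Dv vv' uA; set A := \matrix_i _ in uA.
exists A, (v ord_max); split=> //; rewrite /small_cross -conv_affine.
(* [phi] sends 0, e_n, e_i, e_n - e_i to v_max, v'_max, v_i, v'_i; the last case uses that all pairs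
   have the same sum. *)
pose phi z := z *m A + v ord_max.
have phi0 : phi 0 = v ord_max by rewrite /phi mul0mx add0r.
have phid : phi (basis_vec n d) = v' ord_max.
  by rewrite /phi (basis_vec_mul A ord_max) rowK eqxx subrK.
have phii (i : 'I_n) : (i < d)%N -> phi (basis_vec n i) = v i.
  by move=> id; rewrite /phi basis_vec_mul rowK -val_eqE /= ltn_eqF// subrK.
have phii' (i : 'I_n) : (i < d)%N -> phi (basis_vec n d - basis_vec n i) = v' i.
  move=> id; rewrite /phi mulmxBl.
  rewrite (canRL (addrK _) phid) (canRL (addrK _) (phii i id)) opprB addrA subrK.
  by rewrite addrAC [v' _ + _]addrC -(vv' i) addrAC subrr add0r.
rewrite DE; apply/seteqP; split; apply: conv_sub => _ /mapP[z zs ->].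
  have /Dv[i zi] : D (lat R z) by rewrite DE; apply/conv_mem/map_f.
  apply/conv_mem/mapP.
  have [id|di] := ltnP i d.
    case: zi => ->; [exists (basis_vec n i)|exists (basis_vec n d - basis_vec n i)].
    - by apply/small_cross_verticesP; constructor 3; exists i.
    - by rewrite -/(phi _) phii.
    - by apply/small_cross_verticesP; constructor 4; exists i.
    - by rewrite -/(phi _) phii'.
  have iE : i = ord_max by apply: val_inj => /=; apply/eqP; rewrite eqn_leq di leq_ord.
  rewrite iE in zi.
  case: zi => ->; [exists 0|exists (basis_vec n d)].
  - by apply/small_cross_verticesP; constructor 1.
  - by rewrite -/(phi _) phi0.
  - by apply/small_cross_verticesP; constructor 2.
  - by rewrite -/(phi _) phid.
rewrite -DE -/(phi z); apply/Dv; move/small_cross_verticesP : zs.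
case=> [->|->|[i id ->]|[i id ->]].
- by exists ord_max; left.
- by exists ord_max; right.
- by exists (inord i); left; rewrite -phii inordK// ltnW.
- by exists (inord i); right; rewrite -phii' inordK// ltnW.
Qed.
End SmallCross.

Section SmallCrossPoints.
Variable d : nat.
Local Notation n := d.+1.
Local Notation top := (@ord_max d).
Implicit Types (z : 'rV[int]_n) (t : int) (A : {set 'I_d}).

Lemma basis_vec_top k : basis_vec n d 0 k = (k == top)%:Z.
Proof. by rewrite mxE natz. Qed.

Lemma basis_vec_lift (i : 'I_d) k : basis_vec n i 0 k = (k == lift top i)%:Z.
Proof. by rewrite mxE natz -val_eqE /= /bump leqNgt ltn_ord. Qed.

Lemma basis_decomp z :
  z = \sum_(i < d) z 0 (lift top i) *: basis_vec n i + z 0 top *: basis_vec n d.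
Proof.
apply/rowP => k; rewrite mxE summxE [X in _ + X]mxE basis_vec_top.
under eq_bigr do rewrite mxE basis_vec_lift.
have [j ->|->] := unliftP top k.
  rewrite eq_sym (negPf (neq_lift _ _)) mulr0 addr0 (bigD1 j)//= eqxx mulr1.
  by rewrite big1 ?addr0// => i /negPf ij; rewrite (inj_eq lift_inj) eq_sym ij mulr0.
by rewrite eqxx mulr1 big1 ?add0r// => i _; rewrite (negPf (neq_lift _ _)) mulr0.
Qed.

(* [height A = 0] and [height A = 1] are opposite facets of the cross-polytope. *)
Definition height A z : int := z 0 top + \sum_(i in A) z 0 (lift top i).

Lemma heightB A z z' : height A (z - z') = height A z - height A z'.
Proof.
rewrite /height mxE [X in _ + X](_ : _ =
  \sum_(i in A) z 0 (lift top i) - \sum_(i in A) z' 0 (lift top i)); last first.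
  by rewrite -sumrB; apply: eq_bigr => i _; rewrite !mxE.
by rewrite [(- z') _ _]mxE; ring.
Qed.

Lemma height_top A : height A (basis_vec n d) = 1.
Proof.
rewrite /height basis_vec_top eqxx big1 ?addr0// => i _.
by rewrite basis_vec_top eq_sym (negPf (neq_lift _ _)).
Qed.

Lemma height_lift A (i : 'I_d) : height A (basis_vec n i) = (i \in A)%:Z.
Proof.
rewrite /height basis_vec_lift (negPf (neq_lift _ _)) add0r.
have E k : basis_vec n i 0 (lift top k) = (k == i)%:Z.
  by rewrite basis_vec_lift (inj_eq lift_inj).
under eq_bigr do rewrite E; have [iA|iA] := boolP (i \in A).
  by rewrite (bigD1 i)//= eqxx big1 ?addr0// => k /andP[_ /negPf->].
by rewrite big1// => k kA; case: eqP kA iA => // -> ->.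
Qed.

Lemma height0 A : height A 0 = 0.
Proof. by rewrite /height mxE big1 ?addr0// => i _; rewrite mxE. Qed.

Lemma height_vertices A z : z \in small_cross_vertices n -> 0 <= height A z <= 1.
Proof.
move/small_cross_verticesP => [->|->|[i id ->]|[i id ->]].
- by rewrite height0.
- by rewrite height_top.
- by rewrite (height_lift A (Ordinal id)); case: (_ \in _).
- by rewrite heightB height_top (height_lift A (Ordinal id)); case: (_ \in _).
Qed.

Definition low_form A : 'cV[int]_n * int :=
  (\col_i - (if unlift top i is Some j then j \in A else true)%:Z, 0).
Definition high_form A : 'cV[int]_n * int := (- (low_form A).1, 1).

Lemma ev_low_form A t z : ev (low_form A) t z = height A z.
Proof.
rewrite /ev mulr0 sub0r mxE -sumrN (bigD1_ord top)//= !mxE unlift_none /=.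
rewrite mulrN1 opprK /height; congr (_ + _).
rewrite [RHS]big_mkcond; apply: eq_bigr => i _.
by rewrite !mxE liftK; case: (i \in A); rewrite ?mulrN1 ?oppr0 ?mulr0 ?opprK ?oppr0.
Qed.

Lemma ev_high_form A t z : ev (high_form A) t z = t - height A z.
Proof.
rewrite -(ev_low_form A t) /ev /= mulr1 mulr0 sub0r; congr (_ - _).
by rewrite mulmxN [LHS]mxE.
Qed.

Definition pos_part (a : int) : int := Num.max a 0.
Definition neg_part (a : int) : int := Num.max (- a) 0.

Lemma pos_partE a : pos_part a = if 0 < a then a else 0.
Proof. by rewrite /pos_part maxC maxElt. Qed.

Lemma neg_partE a : - neg_part a = if a < 0 then a else 0.
Proof. by rewrite /neg_part maxC maxElt oppr_gt0 (fun_if -%R) opprK oppr0. Qed.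

Lemma pos_part_ge0 a : 0 <= pos_part a.
Proof. by rewrite /pos_part le_max lexx orbT. Qed.

Lemma neg_part_ge0 a : 0 <= neg_part a.
Proof. by rewrite /neg_part le_max lexx orbT. Qed.

Lemma pos_partB a : pos_part a - neg_part a = a.
Proof. by rewrite pos_partE neg_partE; case: ltgtP; rewrite ?add0r ?addr0. Qed.

(** All conditions 0 <= [height A z] <= t at once: the height is least when [A] collects the
    negative coordinates, and greatest for the positive ones. *)
Definition cross_points t : set 'rV[int]_n := [set z |
  \sum_(i < d) neg_part (z 0 (lift top i)) <= z 0 top /\
  z 0 top + \sum_(i < d) pos_part (z 0 (lift top i)) <= t].

Variable R : realType.

Lemma height_bounds A (x : 'rV[R]_n) t z : 0 < t -> small_cross R n x ->
  lat R z = t%:~R *: x -> 0 <= height A z <= t.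
Proof.
move=> t0 Sx zx; have tR : 0 < t%:~R :> R by rewrite ltr0z.
have vertices f : (forall v, v \in small_cross_vertices n -> 0 <= ev f 1 v) ->
    0 <= ev f t z.
  move=> fv; rewrite -(ler0z R) (aff_real_form_ev _ zx) mulr_ge0 ?(ltW tR)//.
  apply: conv_aff_ge0 Sx => _ /mapP[v vS ->].
  by rewrite aff_real_form_lat ler0z fv.
apply/andP; split.
  rewrite -(ev_low_form A t); apply: vertices => v /(height_vertices A)/andP[].
  by rewrite ev_low_form.
rewrite -subr_ge0 -ev_high_form; apply: vertices => v /(height_vertices A)/andP[_].
by rewrite ev_high_form subr_ge0.
Qed.

Lemma dilate_small_cross t : 0 < t -> dilate_points (small_cross R n) t = cross_points t.
Proof.
move=> t0; have tR : 0 < t%:~R :> R by rewrite ltr0z.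
apply/seteqP; split=> z.
  move=> [x Sx zx]; split.
    have /andP[+ _] := height_bounds [set i | z 0 (lift top i) < 0]%SET t0 Sx zx.
    rewrite -[_ <= z 0 _]subr_ge0 => /le_trans; apply.
    rewrite /height lerD2l -sumrN big_mkcond.
    by apply: ler_sum => i _; rewrite inE neg_partE.
  have /andP[_] := height_bounds [set i | 0 < z 0 (lift top i)]%SET t0 Sx zx.
  apply: le_trans; rewrite /height lerD2l [X in _ <= X]big_mkcond.
  by apply: ler_sum => i _; rewrite inE pos_partE.
move=> [lo hi].
pose V := [seq homog v | v <- [seq lat R z | z <- small_cross_vertices n]].
pose h (y : 'rV[int]_n) (r : int) : 'rV[R]_(n + 1) := row_mx (lat R y) (const_mx r%:~R).
have hD y y' r r' : h (y + y') (r + r') = h y r + h y' r'.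
  rewrite /h add_row_mx /lat map_mxD; congr row_mx.
  by apply/rowP => i; rewrite !mxE intrD.
have hZ a y r : h (a *: y) (a * r) = a%:~R *: h y r.
  rewrite /h scale_row_mx /lat map_mxZ; congr row_mx.
  by apply/rowP => i; rewrite !mxE intrM.
have hS a v : v \in small_cross_vertices n -> 0 <= a -> cone V (h (a *: v) a).
  move=> vS a0; rewrite -[X in h _ X]mulr1 hZ; apply: coneZ; first by rewrite ler0z.
  have -> : h v 1 = homog (lat R v) by [].
  by apply: cone_mem; rewrite /V map_f // map_f.
have h0 : cone V (h 0 0).
  by have := hZ 0 0 0; rewrite scaler0 mulr0 scale0r => ->; exact: cone0.
have hsum (y : 'I_d -> 'rV[int]_n) r : (forall i, cone V (h (y i) (r i))) ->
    cone V (h (\sum_i y i) (\sum_i r i)).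
  by move=> yr; elim/big_rec2: _ => // i r' y' _ hy'; rewrite hD; apply: coneD.
exists (t%:~R^-1 *: lat R z); last by rewrite scalerA divff ?scale1r// gt_eqF.
apply/convP; have -> : homog (t%:~R^-1 *: lat R z) = t%:~R^-1 *: h z t.
  rewrite /h scale_row_mx; congr row_mx; apply/rowP => i; rewrite !mxE mulVf// gt_eqF//.
apply: coneZ; first by rewrite invr_ge0 ltW.
pose p i := pos_part (z 0 (lift top i)); pose m i := neg_part (z 0 (lift top i)).
(* An explicit conic combination of the vertices: the weights of e_i and e_n - e_i are the positive
   and negative parts of z_i, those of e_n and 0 are the slacks in [lo] and [hi]. *)
have -> : h z t = h
  (\sum_(i < d) p i *: basis_vec n i + \sum_(i < d) m i *: (basis_vec n d - basis_vec n i)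
    + (z 0 top - \sum_i m i) *: basis_vec n d + (t - (z 0 top + \sum_i p i)) *: 0)
  (\sum_i p i + \sum_i m i + (z 0 top - \sum_i m i) + (t - (z 0 top + \sum_i p i))).
  congr h; last by ring.
  rewrite scaler0 addr0 {1}[z]basis_decomp.
  have -> : \sum_i m i *: (basis_vec n d - basis_vec n i) =
      (\sum_i m i) *: basis_vec n d - \sum_i m i *: basis_vec n i.
    by rewrite scaler_suml -sumrB; apply: eq_bigr => i _; rewrite scalerBr.
  rewrite scalerBl; set e2 := (\sum_i m i) *: _.
  rewrite [e2 - _]addrC -!addrA [e2 + _]addrC subrK addrA; congr (_ + _).
  by rewrite -sumrB; apply: eq_bigr => i _; rewrite -scalerBl pos_partB.
rewrite !hD; apply: coneD; [apply: coneD; [apply: coneD|]|].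
- by apply: hsum => i; apply: hS; [apply/small_cross_verticesP; constructor 3; exists i
    |exact: pos_part_ge0].
- by apply: hsum => i; apply: hS; [apply/small_cross_verticesP; constructor 4; exists i
    |exact: neg_part_ge0].
- by apply: hS; [apply/small_cross_verticesP; constructor 2|rewrite subr_ge0].
- by apply: hS; [apply/small_cross_verticesP; constructor 1|rewrite subr_ge0].
Qed.

End SmallCrossPoints.

(** * Ehrhart polynomial of the small cross-polytope by sign classes *)

Section SmallCrossCount.
Variable d : nat.
Local Notation n := d.+1.
Local Notation top := (@ord_max d).
Implicit Types (z c : 'rV[int]_n) (A : {set 'I_d}).

Let negs z : {set 'I_d} := [set i | z 0 (lift top i) < 0]%SET.

Let slack_ge0 (a : int) : 0 <= (if a < 0 then - a - 1 else a).
Proof. by case: ltP; lia. Qed.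

Let slack_neg (a : int) :
  (if a < 0 then (if a < 0 then - a - 1 else a) + 1 else 0) = neg_part a.
Proof.
rewrite -[neg_part a]opprK neg_partE; case: ltP => _; last by rewrite oppr0.
by rewrite subrK.
Qed.

Lemma sum_lift (F : 'I_n -> int) : \sum_k F k = F top + \sum_(i < d) F (lift top i).
Proof. by rewrite (bigD1_ord top). Qed.

(* Exchanges a lattice point whose negative coordinates are those in [A] with
   the nonnegative vector of its slacks. *)
Let slack A z : 'rV[int]_n := \row_k
  if unlift top k is Some i then if i \in A then - z 0 k - 1 else z 0 k
  else z 0 top - \sum_(i < d) neg_part (z 0 (lift top i)).

Let unslack A c : 'rV[int]_n := \row_k
  if unlift top k is Some i then if i \in A then - c 0 k - 1 else c 0 k
  else c 0 top + \sum_(i in A) (c 0 (lift top i) + 1).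

Let slack_lift A z i : slack A z 0 (lift top i) =
  if i \in A then - z 0 (lift top i) - 1 else z 0 (lift top i).
Proof. by rewrite mxE liftK. Qed.

Let unslack_lift A c i : unslack A c 0 (lift top i) =
  if i \in A then - c 0 (lift top i) - 1 else c 0 (lift top i).
Proof. by rewrite mxE liftK. Qed.

Let slack_top A z :
  slack A z 0 top = z 0 top - \sum_(i < d) neg_part (z 0 (lift top i)).
Proof. by rewrite mxE unlift_none. Qed.

Let unslack_top A c :
  unslack A c 0 top = c 0 top + \sum_(i in A) (c 0 (lift top i) + 1).
Proof. by rewrite mxE unlift_none. Qed.

Let cardA A : \sum_(i < d) (i \in A)%:Z = #|A|%:Z.
Proof.
rewrite -(big_morph Posz PoszD (erefl _)) -sum1_card [in RHS]big_mkcond.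
by congr Posz; apply: eq_bigr => i _; case: (i \in A).
Qed.

Let slack_part A z i : negs z = A -> slack A z 0 (lift top i) =
  pos_part (z 0 (lift top i)) + neg_part (z 0 (lift top i)) - (i \in A)%:Z.
Proof.
move=> <-; rewrite slack_lift inE pos_partE -[neg_part _]opprK neg_partE.
by case: ltgtP => /=; lia.
Qed.

Let csum_slack A z : negs z = A ->
  csum (slack A z) = z 0 top + \sum_(i < d) pos_part (z 0 (lift top i)) - #|A|%:Z.
Proof.
move=> zA; rewrite /csum sum_lift slack_top.
under [X in _ + X]eq_bigr do rewrite (slack_part _ zA).
by rewrite sumrB big_split /= cardA; ring.
Qed.

Let neg_unslack A c : (forall i, 0 <= c 0 i) ->
  \sum_(i < d) neg_part (unslack A c 0 (lift top i)) =
  \sum_(i in A) (c 0 (lift top i) + 1).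
Proof.
move=> c0; rewrite [RHS]big_mkcond; apply: eq_bigr => i _.
rewrite unslack_lift -[neg_part _]opprK neg_partE.
by have := c0 (lift top i); case: (i \in A); case: ltP; lia.
Qed.

Let pos_unslack A c : (forall i, 0 <= c 0 i) ->
  \sum_(i < d) pos_part (unslack A c 0 (lift top i)) =
  \sum_(i < d) (c 0 (lift top i) + (i \in A)%:Z) - \sum_(i in A) (c 0 (lift top i) + 1).
Proof.
move=> c0; rewrite [X in _ - X]big_mkcond -sumrB; apply: eq_bigr => i _.
rewrite unslack_lift pos_partE.
by have := c0 (lift top i); case: (i \in A); case: ltP; rewrite /=; lia.
Qed.

Let negs_unslack A c : (forall i, 0 <= c 0 i) -> negs (unslack A c) = A.
Proof.
move=> c0; apply/setP => i; rewrite inE unslack_lift.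
by have := c0 (lift top i); case: (i \in A); lia.
Qed.

(** Negative coordinates a become -a - 1 >= 0, and the last coordinate becomes its slack. The units
    subtracted at the coordinates in [A] turn the bound t on the sum into t - |A|, so each [A] of
    size k contributes 1 to the k-th entry of the h^*-vector. *)
Lemma cnt_cross_points_negs A (t : nat) : finite_set (cross_points (d := d) t) ->
  cnt (cross_points (d := d) t%:Z `&` [set z | negs z = A]) = 'C(t + n - #|A|, n).
Proof.
move=> fin; have finA := finite_setIl [set z | negs z = A] fin.
have [At|tA] := leqP #|A| t; last first.
  rewrite bin_small; last by have := max_card A; rewrite card_ord; lia.
  rewrite (_ : _ `&` _ = set0); first by rewrite /cnt fset_set0 cardfs0.
  rewrite -subset0 => z [[lo hi] /= zA].
  have s0 : 0 <= csum (slack A z).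
    apply: sumr_ge0 => k _; have [i ->|->] := unliftP top k; last first.
      by rewrite slack_top subr_ge0.
    rewrite slack_lift -zA inE; exact: slack_ge0.
  by move: s0; rewrite (csum_slack zA); lia.
have -> : (t + n - #|A| = n + (t - #|A|))%N by lia.
have [finC <-] := cnt_dilated_simplex n (t - #|A|).
apply: (cnt_bij (g := slack A) (h := unslack A)) => //.
- move=> z [[lo hi] /= zA]; split; last by rewrite (csum_slack zA) -subzn// lerD2r.
  move=> k; have [i ->|->] := unliftP top k; last by rewrite slack_top subr_ge0.
  by rewrite slack_lift -zA inE; exact: slack_ge0.
- move=> c [c0 cT]; split; last exact: negs_unslack.
  split; first by rewrite neg_unslack// unslack_top lerDr.
  have cs : \sum_(i < d) (c 0 (lift top i) + (i \in A)%:Z) =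
      \sum_(i < d) c 0 (lift top i) + #|A|%:Z by rewrite big_split /= cardA.
  rewrite pos_unslack// unslack_top cs.
  move: cT; rewrite /csum sum_lift -subzn//.
  set C := \sum_(i < d) _; set E := \sum_(i in A) _; lia.
- move=> z [_ /= zA]; apply/rowP => k; have [i ->|->] := unliftP top k.
    by rewrite unslack_lift slack_lift; case: (i \in A); lia.
  rewrite unslack_top slack_top -[RHS](subrK (\sum_(i < d) neg_part (z 0 (lift top i)))).
  congr (_ + _); rewrite big_mkcond; apply: eq_bigr => i _.
  by rewrite slack_lift -zA inE slack_neg.
- move=> c [c0 _]; apply/rowP => k; have [i ->|->] := unliftP top k.
    by rewrite slack_lift unslack_lift; case: (i \in A) => //; ring.
  by rewrite slack_top unslack_top neg_unslack// addrK.
Qed.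

Lemma cnt_cross_points (t : nat) : finite_set (cross_points (d := d) t) ->
  (cnt (cross_points (d := d) t%:Z))%:Z = cross_ehrhart d t.
Proof.
move=> fin; rewrite (cnt_partition negs fin).
under eq_bigr do rewrite cnt_cross_points_negs//.
rewrite (big_morph Posz PoszD (erefl _)) /cross_ehrhart.
rewrite (partition_big (fun A : {set 'I_d} => inord #|A| : 'I_n.+1) xpredT)//=.
apply: eq_bigr => k _.
have E A : (inord #|A| == k :> 'I_n.+1) = (#|A| == k).
  by rewrite -val_eqE /= inordK// ltnS (leq_trans (max_card A))// card_ord.
under eq_bigl do rewrite E.
rewrite (eq_bigr (fun=> ('C(t + n - k, n))%:Z)) => [|A /eqP->//].
rewrite sumr_const -mulr_natl natz; congr (_%:Z * _).
by have := card_draws 'I_d k; rewrite card_ord => <-; apply: eq_card => A; rewrite inE.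
Qed.

Lemma ehrhart_small_cross (R : realType) (t : nat) : (0 < t)%N ->
  (ehrhart (small_cross R n) t)%:Z = cross_ehrhart d t.
Proof.
move=> t0; rewrite ehrhart_cnt dilate_small_cross// cnt_cross_points//.
by rewrite -(dilate_small_cross d R)//; exact: dilate_points_finite.
Qed.

End SmallCrossCount.

(** * The small cross-polytope is a toric diagram *)

Section ConvFace.
Variables (R : realType) (n : nat).
Implicit Types (s : seq 'rV[R]_n) (l : 'cV[R]_(n + 1)) (x : 'rV[R]_n).

Lemma conv_face s l : (forall v, v \in s -> 0 <= aff l v) ->
  conv s `&` [set x | aff l x = 0] = conv [seq v <- s | aff l v == 0].
Proof.
move=> sl; apply/seteqP; split=> x; last first.
  move=> sx; split.
    by apply: conv_sub sx => v; rewrite mem_filter => /andP[_]; exact: conv_mem.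
  by apply: conv_aff_eq0 sx => v; rewrite mem_filter => /andP[/eqP].
move=> [/convP sx xl]; apply/convP; move: sx xl; rewrite /aff /=.
(* Subtracting generators leaves the vectors of the form [homog x], so the induction is over all
   vectors of the cone on which [l] vanishes. *)
elim: s sl (homog x) => //= v s IH sl y [c c0 sy] yl.
have sl' w : w \in s -> 0 <= aff l w by move=> ws; apply: sl; rewrite inE ws orbT.
have vl := sl v (mem_head _ _).
have y'l : 0 <= ((y - c *: homog v) *m l) 0 0.
  by apply: cone_ge0 sy => _ /mapP[w ws ->]; exact: sl'.
have yE : c * aff l v + ((y - c *: homog v) *m l) 0 0 = 0.
  rewrite mulmxBl -scalemxAl [X in _ + X]mxE [X in _ + (_ + X)]mxE yl add0r.
  by rewrite [X in _ - X]mxE subrr.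
have cv0 : c * aff l v = 0.
  by apply/eqP; rewrite eq_le mulr_ge0// andbT -yE lerDl.
have {}IH := IH sl' _ sy; rewrite cv0 add0r in yE; have {}IH := IH yE.
case: eqP cv0 => [_ _|/eqP vl0 /eqP]; first by exists c.
by rewrite mulf_eq0 (negPf vl0) orbF => /eqP cz; rewrite cz scale0r subr0 in IH.
Qed.

Lemma cone_submx m (W : 'M[R]_(m, n)) (V : seq 'rV[R]_n) y :
  (forall v, v \in V -> (v <= W)%MS) -> cone V y -> (y <= W)%MS.
Proof.
elim: V y => [|v V IH] y VW; rewrite ?cone_nil ?cone_cons.
  by move=> ->; exact: sub0mx.
move=> [c _ Vy]; rewrite -[y](subrK (c *: v)) addmx_sub//; last first.
  by rewrite scalemx_sub// VW ?mem_head.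
by apply: IH => // w wV; apply: VW; rewrite inE wV orbT.
Qed.

End ConvFace.

Lemma unimodular_is_simplex (R : realType) n (F : set 'rV[R]_n) :
  unimodular_simplex F -> is_simplex F.
Proof.
move=> [w [u [FE uM]]]; exists n, (\matrix_i lat R (tnth w i)); split; last first.
  rewrite FE; apply: conv_eq => x; apply/mapP/mapP => [[z /tnthP[i ->] ->]|[i _ ->]].
    by exists i; rewrite ?mem_enum// rowK.
  by exists (tnth w i); rewrite ?mem_tnth// rowK.
apply: inj_row_free => c /eqP; rewrite mul_mx_row row_mx_eq0 => /andP[/eqP cw /eqP c1].
pose M := \matrix_(i < n) (tnth w i + u).
have MM' : map_mx intr M *m map_mx intr (invmx M) = 1%:M :> 'M[R]_n.
  by rewrite -map_mxM mulmxV// map_mx1.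
have ME : map_mx intr M = \matrix_i lat R (tnth w i) + const_mx 1 *m lat R u :> 'M[R]_n.
  by apply/matrixP => j k; rewrite !mxE big_ord1 !mxE mul1r intrD.
have : c *m map_mx intr M = 0 by rewrite ME mulmxDr cw mulmxA c1 mul0mx addr0.
by move/(congr1 (mulmx^~ (map_mx intr (invmx M)))); rewrite -mulmxA MM' mulmx1 mul0mx.
Qed.

Section SmallCrossToric.
Variables (R : realType) (d : nat).
Local Notation n := d.+1.
Local Notation top := (@ord_max d).
Local Notation S := (small_cross R n).
Local Notation center2 := (basis_vec n d).

(** One vertex of each of the n antipodal pairs; [center2] is twice the centre of symmetry, and the
    pair of the last index is {0, e_n}. *)
Definition pair_vertex (k : 'I_n) : 'rV[int]_n := if k == top then 0 else basis_vec n k.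

Lemma small_cross_pairs z : z \in small_cross_vertices n <->
  exists k, z = pair_vertex k \/ z = center2 - pair_vertex k.
Proof.
have ltop (k : 'I_n) : k != top -> (k < d)%N.
  by rewrite -val_eqE /= => kd; rewrite ltn_neqAle kd leq_ord.
split=> [/small_cross_verticesP|[k]].
  rewrite /pair_vertex; case=> [->|->|[i id ->]|[i id ->]].
  - by exists top; left; rewrite eqxx.
  - by exists top; right; rewrite eqxx subr0.
  - exists (lift top (Ordinal id)); left.
    by rewrite eq_sym (negPf (neq_lift _ _)) lift_max.
  - exists (lift top (Ordinal id)); right.
    by rewrite eq_sym (negPf (neq_lift _ _)) lift_max.
move=> H; apply/small_cross_verticesP; move: H; rewrite /pair_vertex.
have [_|/ltop kd] := eqVneq k top; rewrite ?subr0; case=> ->.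
- by constructor 1.
- by constructor 2.
- by constructor 3; exists k.
- by constructor 4; exists k.
Qed.

Lemma small_cross_dim : has_dim S n.
Proof.
split; last first.
  move=> [P [/eqP rP _]]; have := rank_leq_col (row_mx P (const_mx 1 : 'cV[R]_n.+2)).
  by rewrite rP addn1 ltnn.
pose P : 'M[R]_(n.+1, n) :=
  \matrix_i (if unlift ord0 i is Some j then lat R (basis_vec n j) else 0).
have PE i j : P i j = (i == lift ord0 j)%:R.
  rewrite mxE; case: unliftP => [k ->|->]; last by rewrite mxE (negPf (neq_lift _ _)).
  by rewrite !mxE (inj_eq lift_inj) eq_sym rmorph_nat.
exists P; split.
  apply: inj_row_free => c /eqP; rewrite mul_mx_row row_mx_eq0 => /andP[/eqP cP /eqP c1].
  have cj j : c 0 (lift ord0 j) = 0.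
    move/rowP/(_ j): cP; rewrite [X in _ = X]mxE => <-.
    rewrite mxE (bigD1 (lift ord0 j))//= PE eqxx mulr1 big1 ?addr0// => i /negPf ij.
    by rewrite PE ij mulr0.
  apply/rowP => i; have [j ->|->] := unliftP ord0 i; first by rewrite cj mxE.
  move/rowP/(_ 0): c1; rewrite mxE big_ord_recl big1 ?addr0 => [|j _]; last first.
    by rewrite cj mul0r.
  by rewrite !mxE mulr1.
move=> i; rewrite rowK; case: unlift => [j|].
  apply/conv_mem/map_f/small_cross_pairs.
  have [->|jt] := eqVneq j top.
    by exists top; right; rewrite /pair_vertex eqxx subr0.
  by exists j; left; rewrite /pair_vertex (negPf jt).
have -> : (0 : 'rV[R]_n) = lat R 0 by rewrite /lat map_mx0.
by apply/conv_mem/map_f/small_cross_pairs; exists top; left; rewrite /pair_vertex eqxx.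
Qed.

Lemma pair_vertex_in k : pair_vertex k \in small_cross_vertices n.
Proof. by apply/small_cross_pairs; exists k; left. Qed.

Lemma pair_antipode_in k : center2 - pair_vertex k \in small_cross_vertices n.
Proof. by apply/small_cross_pairs; exists k; right. Qed.

Lemma aff_antipode (l : 'cV[R]_(n + 1)) k :
  aff l (lat R (pair_vertex k)) + aff l (lat R (center2 - pair_vertex k)) =
  aff l 0 + aff l (lat R center2).
Proof.
rewrite -[LHS]/((_ *m l) 0 0 + (_ *m l) 0 0) -[RHS]/((_ *m l) 0 0 + (_ *m l) 0 0).
have mxD (a b : 'M[R]_1) : a 0 0 + b 0 0 = (a + b) 0 0 by rewrite mxE.
rewrite !mxD -!mulmxDl /homog !add_row_mx; congr ((row_mx _ _ *m _) 0 0).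
by rewrite /lat map_mxB addrC subrK add0r.
Qed.

Definition choice_vertex (b : 'I_n -> bool) k : 'rV[int]_n :=
  if b k then center2 - pair_vertex k else pair_vertex k.

(** The shift turns the vertex chosen from {0, e_n} into e_n; modulo e_n the other rows are the e_i
    up to sign. *)
Lemma choice_unimodular b : exists u : 'rV[int]_n,
  \matrix_i (choice_vertex b i + u) \in unitmx.
Proof.
exists (if b top then 0 else center2); set M := \matrix_i _.
have mxD (x y : 'rV[int]_n) j : (x + y) 0 j = x 0 j + y 0 j by rewrite mxE.
have mx0 j : (0 : 'rV[int]_n) 0 j = 0 by rewrite mxE.
have mxB (x y : 'rV[int]_n) j : (x - y) 0 j = x 0 j - y 0 j by rewrite !mxE.
have ME i j : j != top -> M i j =
    if i == j then (if b i then -1 else 1) else 0.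
  move=> jt; have c0 : center2 0 j = 0 by rewrite basis_vec_top (negPf jt).
  have u0 : (if b top then 0 else center2) 0 j = 0 by case: ifP; rewrite ?c0// mxE.
  have pE : pair_vertex i 0 j = (i == j)%:Z.
    rewrite /pair_vertex; have [->|_] := eqVneq i top.
      by rewrite mxE eq_sym (negPf jt).
    by rewrite mxE natz eq_sym.
  rewrite mxE mxD u0 addr0 /choice_vertex.
  case: (b i); last by rewrite pE; case: (i == j).
  by rewrite mxB c0 pE add0r; case: (i == j).
have Mtop : M top top = 1.
  rewrite mxE mxD /choice_vertex /pair_vertex eqxx subr0; case: (b top).
    by rewrite mx0 addr0 basis_vec_top eqxx.
  by rewrite mx0 add0r basis_vec_top eqxx.
rewrite unitmxE -det_tr det_trig; last first.
  apply/is_trig_mxP => i j ij; rewrite mxE.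
  have it : i != top by rewrite -val_eqE /= neq_ltn (leq_trans ij) ?leq_ord.
  by rewrite ME// -val_eqE /= gtn_eqF.
apply: rpred_prod => i _; rewrite mxE; have [->|it] := eqVneq i top.
  by rewrite Mtop unitr1.
by rewrite ME// eqxx; case: (b i).
Qed.

(** A facet contains exactly one vertex of each pair. With both, all pair sums of the nonnegative
    form vanish and the facet is the whole polytope; with neither, too few vertices remain to span
    it. *)
Lemma small_cross_facet F : is_facet S F -> unimodular_simplex F.
Proof.
move=> [/is_face_aff[l [Sl FE]] [[P [rP FP]] nF]].
pose verts := [seq lat R z | z <- small_cross_vertices n].
have l_ge0 v : v \in verts -> 0 <= aff l v by move=> /conv_mem; exact: Sl.
rewrite /small_cross conv_face// in FE.
pose L z := aff l (lat R z).
have L_ge0 z : z \in small_cross_vertices n -> 0 <= L z.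
  by move=> zS; apply/l_ge0/map_f.
have not_both k : ~ (L (pair_vertex k) = 0 /\ L (center2 - pair_vertex k) = 0).
  move=> [Lk Lk']; have all0 z : z \in small_cross_vertices n -> L z = 0.
    have sum0 : aff l 0 + aff l (lat R center2) = 0.
      by rewrite -(aff_antipode l k) -/(L _) Lk -/(L _) Lk' addr0.
    move=> /small_cross_pairs[i zi].
    have := aff_antipode l i; rewrite sum0 -/(L _) -/(L (_ - _)).
    have := L_ge0 _ (pair_vertex_in i); have := L_ge0 _ (pair_antipode_in i).
    by case: zi => ->; lra.
  apply: nF; have [[P' [rP' SP']] _] := small_cross_dim.
  exists P'; split=> // i; rewrite FE -conv_face//; split; first exact: SP'.
  by apply: conv_aff_eq0 (SP' i) => _ /mapP[z zS ->]; exact: all0.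
pose b k := L (pair_vertex k) != 0.
have zeros z : z \in small_cross_vertices n -> L z = 0 -> exists k, z = choice_vertex b k.
  move=> /small_cross_pairs[k zk] Lz; exists k; rewrite /choice_vertex /b.
  case: zk Lz => -> Lz; first by rewrite Lz eqxx.
  by case: eqP => // Lz'; case: (not_both k).
have one k : L (choice_vertex b k) = 0.
  apply: contrapT => Lk.
  have Lk1 : L (pair_vertex k) <> 0.
    by move=> L0; apply: Lk; rewrite /choice_vertex /b L0 eqxx.
  have Lk2 : L (center2 - pair_vertex k) <> 0.
    move=> L0; apply: Lk; rewrite /choice_vertex /b; case: eqP => //.
  (* If the pair [k] misses the facet, the n - 1 nonzero rows of [W] span all its homogenized
     points, against the rank n of those in [P]. *)
  pose W : 'M[R]_(n, n + 1) :=
    \matrix_i (if i == k then 0 else homog (lat R (choice_vertex b i))).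
  have : (\rank W < n)%N.
    rewrite ltn_neqAle rank_leq_row andbT; apply/negP => /row_freeP[B /(congr1 (row k))].
    rewrite row_mul rowK eqxx mul0mx => /rowP/(_ k)/eqP.
    by rewrite !mxE eqxx eq_sym oner_eq0.
  apply/negP; rewrite -leqNgt.
  apply: (@leq_trans (\rank (row_mx P (const_mx 1 : 'cV[R]_n)))).
    by rewrite (eqP rP).
  apply: mxrankS; apply/row_subP => i; rewrite row_homog.
  have := FP i; rewrite FE => /convP Pi; apply: (cone_submx _ Pi) => v /mapP[y + ->] {v}.
  rewrite mem_filter => /andP[/eqP + /mapP[z zS yz]]; rewrite {}yz => Lz.
  have [j zj] := zeros z zS Lz.
  suff -> : homog (lat R z) = row j W by exact: row_sub.
  rewrite rowK zj; case: eqVneq => // jk; case: Lk; by rewrite -jk -zj.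
have [u uM] := choice_unimodular b.
exists [tuple choice_vertex b k | k < n], u; split.
  rewrite FE; apply: conv_eq => x; rewrite mem_filter; apply/andP/mapP.
    move=> [/eqP + /mapP[z zS xz]]; rewrite xz => Lz; have [k ->] := zeros z zS Lz.
    by exists (choice_vertex b k) => //; apply/tnthP; exists k; rewrite tnth_mktuple.
  move=> [z /tnthP[k ->] ->]; rewrite tnth_mktuple; split; first by apply/eqP/one.
  apply: map_f; rewrite /choice_vertex; case: (b k).
    exact: pair_antipode_in.
  exact: pair_vertex_in.
by under eq_mx do rewrite tnth_mktuple.
Qed.

Lemma small_cross_toric : toric_diagram S.
Proof.
split; first by exists (small_cross_vertices n).
- exact: small_cross_dim.
- by move=> F /small_cross_facet; exact: unimodular_is_simplex.
- exact: small_cross_facet.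
Qed.

End SmallCrossToric.

(** * The moment cone *)

Section Prequantization.
Variable d : nat.
Local Notation n := d.+1.
Local Notation top := (@ord_max d).

Local Notation low j := (lshift 1 (j : 'I_n)).
Local Notation last := (rshift n (0 : 'I_1)).

(* The image of [(x, r)] under the isomorphism from the cone over the cube: for
   [y] in the moment cone and [e_n] the last basis vector, [last] is the pairing
   with [(0, 1)], and the pairings with [(e_i, 1)] and [(e_n, 1)] are [x_i] and
   [r - x_n]. *)
Definition to_moment (T : comNzRingType) (v : 'rV[T]_(n + 1)) : 'rV[T]_(n + 1) :=
  \row_k match fintype.split k with
         | inl j => if j == top then v 0 last - 2 * v 0 (low top)
                    else v 0 (low j) - v 0 (low top)
         | inr _ => v 0 (low top)
         end.

Definition of_moment (T : comNzRingType) (y : 'rV[T]_(n + 1)) : 'rV[T]_(n + 1) :=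
  \row_k match fintype.split k with
         | inl j => if j == top then y 0 last else y 0 (low j) + y 0 last
         | inr _ => y 0 (low top) + 2 * y 0 last
         end.

Lemma to_moment_low (T : comNzRingType) (v : 'rV[T]_(n + 1)) j :
  to_moment v 0 (low j) = if j == top then v 0 last - 2 * v 0 (low top)
                          else v 0 (low j) - v 0 (low top).
Proof. by rewrite mxE -[lshift _ _]/(unsplit (inl j)) unsplitK. Qed.

Lemma to_moment_last (T : comNzRingType) (v : 'rV[T]_(n + 1)) :
  to_moment v 0 last = v 0 (low top).
Proof. by rewrite mxE -[rshift _ _]/(unsplit (inr 0)) unsplitK. Qed.

Lemma of_moment_low (T : comNzRingType) (y : 'rV[T]_(n + 1)) j :
  of_moment y 0 (low j) = if j == top then y 0 last else y 0 (low j) + y 0 last.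
Proof. by rewrite mxE -[lshift _ _]/(unsplit (inl j)) unsplitK. Qed.

Lemma of_moment_last (T : comNzRingType) (y : 'rV[T]_(n + 1)) :
  of_moment y 0 last = y 0 (low top) + 2 * y 0 last.
Proof. by rewrite mxE -[rshift _ _]/(unsplit (inr 0)) unsplitK. Qed.

Lemma of_momentK (T : comNzRingType) : cancel (@of_moment T) (@to_moment T).
Proof.
move=> y; apply/rowP => k; case: (split_ordP k) => j ->; last first.
  by rewrite ord1 to_moment_last of_moment_low eqxx.
rewrite to_moment_low of_moment_last !of_moment_low eqxx.
by case: eqVneq => [->|_]; ring.
Qed.

Lemma to_momentK (T : comNzRingType) : cancel (@to_moment T) (@of_moment T).
Proof.
move=> v; apply/rowP => k; case: (split_ordP k) => j ->; last first.
  by rewrite ord1 of_moment_last to_moment_low to_moment_last eqxx; ring.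
rewrite of_moment_low to_moment_low to_moment_last.
by case: eqVneq => [->//|_]; ring.
Qed.

Lemma to_moment_is_linear (T : comNzRingType) : linear (@to_moment T).
Proof.
move=> a v v'; apply/rowP => k; rewrite [RHS]mxE [X in _ = X + _]mxE.
case: (split_ordP k) => j ->; last by rewrite ord1 !to_moment_last !mxE.
by rewrite !to_moment_low !mxE; case: ifP => _; ring.
Qed.

Lemma of_moment_is_linear (T : comNzRingType) : linear (@of_moment T).
Proof.
move=> a v v'; apply/rowP => k; rewrite [RHS]mxE [X in _ = X + _]mxE.
case: (split_ordP k) => j ->; last by rewrite ord1 !of_moment_last !mxE; ring.
by rewrite !of_moment_low !mxE; case: ifP => _ //; ring.
Qed.

HB.instance Definition _ (T : comNzRingType) :=
  GRing.isLinear.Build T _ _ _ (@to_moment T) (@to_moment_is_linear T).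

HB.instance Definition _ (T : comNzRingType) :=
  GRing.isLinear.Build T _ _ _ (@of_moment T) (@of_moment_is_linear T).

Lemma to_moment_unit : lin1_mx (@to_moment int) \in unitmx.
Proof.
suff H : lin1_mx (@of_moment int) *m lin1_mx (@to_moment int) = 1%:M.
  by case: (mulmx1_unit H).
apply/row_matrixP => i.
by rewrite row_mul rowE !mul_rV_lin1 /= of_momentK row1.
Qed.

Lemma map_to_moment (R : comNzRingType) :
  map_mx intr (lin1_mx (@to_moment int)) = lin1_mx (@to_moment R).
Proof.
apply/matrixP => i k; rewrite !mxE; case: (fintype.split k) => j; last first.
  by rewrite rmorph_nat.
by case: ifP => _; rewrite ?mxE !rmorphB ?rmorphM !rmorph_nat.
Qed.

(** In the coordinates (x, r) of [of_moment] the pairings with the two vertices of pair j are x_j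
    and r - x_j, so the moment cone is given by 0 <= x_j <= r. *)
Lemma small_cross_prequantization (R : realType) :
  prequantization_diagram (unit_cube R n) (small_cross R n).
Proof.
exists (lin1_mx (@to_moment int)); first exact: to_moment_unit.
rewrite map_to_moment.
have pairing (y : 'rV[R]_(n + 1)) x : dot y (row_mx x (const_mx 1)) = aff y^T x.
  rewrite /dot /aff mxE; apply: eq_bigr => i _; rewrite [y^T _ _]mxE mulrC.
  by [].
have affE y z : aff y^T (lat R z) =
    \sum_(j < n) y 0 (low j) * (z 0 j)%:~R + y 0 last.
  rewrite -pairing /dot big_split_ord /= big_ord1 row_mxEr mxE mulr1; congr (_ + _).
  by apply: eq_bigr => j _; rewrite row_mxEl mxE.
have affi y (j : 'I_n) : aff y^T (lat R (basis_vec n j)) = y 0 (low j) + y 0 last.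
  rewrite affE (bigD1 j)//= mxE eqxx mulr1 big1 ?addr0// => k /negPf kj.
  by rewrite mxE val_eqE kj mulr0.
have aff0 y : aff y^T (lat R 0) = y 0 last.
  by rewrite affE big1 ?add0r// => k _; rewrite mxE mulr0.
have aff00 (y : 'rV[R]_(n + 1)) : aff y^T 0 = y 0 last by rewrite -(aff0 y) /lat map_mx0.
have pairE y j : aff y^T (lat R (pair_vertex j)) = of_moment y 0 (low j).
  rewrite of_moment_low /pair_vertex; case: eqVneq => [_|_]; first exact: aff0.
  exact: affi.
have antiE y j : aff y^T (lat R (basis_vec n d - pair_vertex j)) =
    of_moment y 0 last - of_moment y 0 (low j).
  apply/eqP; rewrite eq_sym subr_eq addrC -pairE aff_antipode (affi y top).
  by rewrite of_moment_last aff00; apply/eqP; ring.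
have coneP y : moment_cone (small_cross R n) y <->
    forall j : 'I_n, 0 <= of_moment y 0 (low j) <= of_moment y 0 last.
  split=> [yS j|yj v Sv].
    have yv z : z \in small_cross_vertices n -> 0 <= aff y^T (lat R z).
      by move=> zS; rewrite -pairing; apply/yS/conv_mem/map_f.
    rewrite -pairE yv ?pair_vertex_in//= pairE -subr_ge0 -antiE yv//.
    exact: pair_antipode_in.
  rewrite pairing; apply: conv_aff_ge0 Sv => _ /mapP[z /small_cross_pairs[j zj] ->].
  have /andP[y0 yr] := yj j.
  by case: zj => ->; rewrite ?pairE// antiE subr_ge0.
have cubeP (v : 'rV[R]_(n + 1)) :
    (forall j : 'I_n, 0 <= v 0 (low j) <= v 0 last) -> cone_over (unit_cube R n) v.
  set r := v 0 last => vr; have r0 : 0 <= r by have /andP[/le_trans H /H] := vr top.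
  exists r, (r^-1 *: lsubmx v); split=> //.
    move=> j; rewrite 2!mxE; have /andP[vj vjr] := vr j.
    (* For r = 0 the inverse is 0, so the witness is the origin of the cube; the bounds [vr] then
       force [v] to vanish. *)
    have [rz|rn] := eqVneq r 0; first by rewrite rz invr0 mul0r lexx ler01.
    have rp : 0 < r by rewrite lt_def rn.
    by rewrite mulr_ge0 ?invr_ge0//= mulrC ler_pdivrMr// mul1r.
  rewrite scale_row_mx; apply/rowP => k; case: (split_ordP k) => j ->; last first.
    by rewrite ord1 row_mxEr !mxE mulr1.
  rewrite row_mxEl 3!mxE.
  have [rz|rn] := eqVneq r 0; last by rewrite mulrA divff// mul1r.
  by rewrite rz mul0r; apply/eqP; rewrite eq_le; have := vr j; rewrite rz => /andP[-> ->].
apply/seteqP; split=> y.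
  move=> /coneP yx; exists (of_moment y); last by rewrite mul_rV_lin1 /= of_momentK.
  exact: cubeP.
move=> [v [r [x [r0 x01 ->]]] <-]; apply/coneP => j.
rewrite mul_rV_lin1 /= to_momentK scale_row_mx row_mxEl row_mxEr !mxE mulr1.
have /andP[x0 x1] := x01 j.
by rewrite mulr_ge0//= ler_piMr.
Qed.

End Prequantization.

(** * Contact Betti numbers of the small cross-polytope *)

Section ContactBetti.
Variable d : nat.
Local Notation n := d.+1.

Definition cross_hstar (j : int) : int := if j is Posz m then ('C(d, m))%:Z else 0.

(** Partial sums of the h^*-vector from its top entry down. The test on [a] stops the truncated n -
    a from contributing C(d,0) = 1 for a > n. *)
Definition cross_betti (i : int) : nat :=
  if i is Posz m then
    if odd m then 0%N
    else (\sum_(a < (m./2).+1) if (a <= n)%N then 'C(d, n - a) else 0)%N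
  else 0%N.

Lemma small_cross_hstar (R : realType) (D : set 'rV[R]_n) :
  is_hstar D cross_hstar <->
  forall t : nat, (0 < t)%N -> (ehrhart D t)%:Z = cross_ehrhart d t.
Proof.
split=> [[_ hD] t t0|hD]; first by rewrite hD.
split=> [[m|m] //=|t t0]; last by rewrite hD.
by rewrite ltz_nat => nm; rewrite bin_small//; lia.
Qed.

Lemma cross_betti_hstar (k : int) :
  cross_hstar (n%:Z - k) = (cross_betti (2 * k))%:Z - (cross_betti (2 * (k - 1)))%:Z.
Proof.
have even m : cross_betti (2 * m%:Z) =
    (\sum_(a < m.+1) if (a <= n)%N then 'C(d, n - a) else 0)%N.
  by rewrite /cross_betti -PoszM mul2n odd_double doubleK.
have neg m : cross_betti (2 * Negz m) = 0%N by [].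
case: k => [[|m]|m].
- rewrite (even 0%N) big_ord1 subn0 subr0 /= bin_small//.
- have -> : m.+1%:Z - 1 = m%:Z by lia.
  rewrite !even big_ord_recr PoszD addrAC subrr add0r /=.
  case: leqP => mn; last by rewrite subzn.
  by have -> : n%:Z - m.+1%:Z = Negz (m - n) by lia.
- have -> : Negz m - 1 = Negz m.+1 by lia.
  rewrite !neg subrr; have -> : n%:Z - Negz m = (n + m.+1)%N%:Z by lia.
  by rewrite /= bin_small//; lia.
Qed.

(** The differences of the Betti numbers determine the h^*-vector at every integer, so equal Betti
    numbers mean equal Ehrhart functions. *)
Lemma contact_betti_cross (R : realType) (D : set 'rV[R]_n) :
  contact_betti D cross_betti <->
  forall t : nat, (0 < t)%N -> (ehrhart D t)%:Z = cross_ehrhart d t.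
Proof.
rewrite -small_cross_hstar; split=> [[_ _ [h hD hE]]|hD].
  suff <- : h = cross_hstar by [].
  apply/funext => j; rewrite -[j](subKr n%:Z) hE cross_betti_hstar.
  by [].
split=> [[m|m] //|[m|m]|].
- by rewrite /cross_betti -PoszM -PoszD addn1 /= mul2n odd_double.
- by have -> : 2 * Negz m + 1 = Negz (2 * m) by lia.
- by exists cross_hstar => // k; exact: cross_betti_hstar.
Qed.

End ContactBetti.

Theorem theorem1p5 (R : realType) (n : nat) (hn : (1 <= n)%N) :
  [/\ toric_diagram (small_cross R n),
      prequantization_diagram (unit_cube R n) (small_cross R n)
    & rigid (small_cross R n)].
Proof.
case: n hn => // d _; split.
- exact: small_cross_toric.
- exact: small_cross_prequantization.
exists (cross_betti d) => [|D toricD /contact_betti_cross ehrhartD].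
  by apply/contact_betti_cross => t; exact: ehrhart_small_cross.
have [latD _ _ _] := toricD; have [s DE] := latD; rewrite {}DE in toricD ehrhartD latD *.
have [v [v' [Dv vv' unitA]]] := toric_cross_structure toricD ehrhartD.
exact: cross_structure_equiv latD Dv vv' unitA.
Qed.
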